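(* For all natural numbers $s$ and $q$ there is a number $X=X(s,q)$ such that every graph of treewidth at least $X$ contains either a canonical graph of order at least $s$ as an induced subgraph or the biclique $K_{q,q}$ as a (not necessarily induced) subgraph.
   Context: All graphs are finite, simple, undirected. For $i\ge 1$, $H_i$ is the graph obtained from a path $u_0\cdots u_i$ by attaching two pendant vertices to $u_0$ and two to $u_i$; $H'_i$ is obtained from $H_i$ by joining the two pendant vertices at one end, and $H''_i$ by joining both such pairs. An $H$-graph is any $H_i$, $H'_i$ or $H''_i$, with body the path $u_0\cdots u_i$. A hole is a chordless cycle of length at least four. A canonical graph is a hole or an $H$-graph; its order is its number of vertices for a hole, and the number of vertices of its body for an $H$-graph. *)

(* Defs.v *)
From mathcomp Require Import all_boot.
From mathcomp Require Import boolp.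

Set Implicit Arguments.
Unset Strict Implicit.
Unset Printing Implicit Defensive.

(** ** Finite simple graphs *)

Record sgraph := SGraph {
  vertex :> finType;
  adj : rel vertex;
  adj_sym : symmetric adj;
  adj_irr : irreflexive adj }.

Definition subgraph (H G : sgraph) : Prop :=
  exists2 f : H -> G, injective f &
    forall x y : H, adj x y -> adj (f x) (f y).

Definition induced_subgraph (H G : sgraph) : Prop :=
  exists2 f : H -> G, injective f &
    forall x y : H, adj (f x) (f y) = adj x y.

(** ** Treewidth *)

Definition connected_graph (G : sgraph) : Prop :=
  forall x y : G, connect (@adj G) x y.

(* [ucycle] also accepts the degenerate cycles [:: x; y] along one edge. *)
Definition acyclic_graph (G : sgraph) : Prop :=
  forall c : seq G, ucycle (@adj G) c -> size c <= 2.

Definition is_tree (T : sgraph) : Prop :=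
  [/\ 0 < #|T|, connected_graph T & acyclic_graph T].

Record tree_decomposition (G T : sgraph) (bag : T -> {set G}) : Prop :=
  TreeDecomposition {
    td_tree : is_tree T;
    td_vertex : forall v : G, exists t : T, v \in bag t;
    td_edge : forall u v : G, adj u v ->
      exists t : T, (u \in bag t) && (v \in bag t);
    (* The nodes whose bags contain [v] induce a connected subgraph of [T]. *)
    td_connected : forall (v : G) (s t : T), v \in bag s -> v \in bag t ->
      connect [rel a b | [&& adj a b, v \in bag a & v \in bag b]] s t }.

(* The width of the graph without vertices is 0 here rather than -1. *)
Definition width (G T : sgraph) (bag : T -> {set G}) : nat :=
  (\max_(t : T) #|bag t|).-1.

Definition has_decomposition_of_width (G : sgraph) (k : nat) : Prop :=
  exists (T : sgraph) (bag : T -> {set G}),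
    tree_decomposition bag /\ width bag = k.

Definition single_vertex : sgraph :=
  @SGraph unit (fun _ _ => false) (fun _ _ => erefl) (fun _ => erefl).

Lemma has_decomposition (G : sgraph) :
  exists k : nat, `[< has_decomposition_of_width G k >].
Proof.
exists (width (fun _ : single_vertex => [set: G])); apply/asboolP.
exists single_vertex, (fun _ => [set: G]); split=> //; split.
- split; first by rewrite card_unit.
  + by move=> [] [].
  + by case=> [|x [|y c]] //=; case/andP.
- by move=> v; exists tt; rewrite inE.
- by move=> u v _; exists tt; rewrite !inE.
- by move=> v [] [].
Qed.

Definition treewidth (G : sgraph) : nat := ex_minn (has_decomposition G).

Lemma treewidthP (G : sgraph) :
  has_decomposition_of_width G (treewidth G) /\
  forall k, has_decomposition_of_width G k -> treewidth G <= k.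
Proof.
rewrite /treewidth; case: ex_minnP => m /asboolP Gm minm.
by split=> // k Gk; apply: minm; apply/asboolP.
Qed.

(** ** Bicliques and canonical graphs *)

Definition biclique_adj (q : nat) : rel ('I_q + 'I_q) :=
  fun x y => match x, y with
  | inl _, inr _ | inr _, inl _ => true
  | _, _ => false
  end.

Lemma biclique_adj_sym q : symmetric (@biclique_adj q).
Proof. by move=> [] x [] y. Qed.

Lemma biclique_adj_irr q : irreflexive (@biclique_adj q).
Proof. by move=> []. Qed.

Definition biclique (q : nat) : sgraph :=
  SGraph (@biclique_adj_sym q) (@biclique_adj_irr q).

(* The disequality only matters for n = 1. *)
Definition cycle_adj (n : nat) : rel 'I_n :=
  fun x y => (x != y) && ((y == ordS x) || (x == ordS y)).

Lemma cycle_adj_sym n : symmetric (@cycle_adj n).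
Proof. by move=> x y; rewrite /cycle_adj eq_sym orbC. Qed.

Lemma cycle_adj_irr n : irreflexive (@cycle_adj n).
Proof. by move=> x; rewrite /cycle_adj eqxx. Qed.

Definition cycle_graph (n : nat) : sgraph :=
  SGraph (@cycle_adj_sym n) (@cycle_adj_irr n).

(* [inl j] is the vertex u_j of the body; [inr (false, c)] and [inr (true, c)],
   for c : bool, are the two pendant vertices attached to u_0 and to u_i
   respectively. The pendant vertices attached to u_0 (resp. u_i) are joined to
   each other iff [join0] (resp. [joini]). *)
Definition H_adj (join0 joini : bool) (i : nat) :
    rel ('I_i.+1 + bool * bool) :=
  fun x y => match x, y with
  | inl j, inl k => (j.+1 == k) || (k.+1 == j)
  | inl j, inr (e, _) | inr (e, _), inl j =>
      j == (if e then ord_max else ord0)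
  | inr (e, c), inr (e', c') =>
      [&& e == e', c != c' & if e then joini else join0]
  end.

Lemma H_adj_sym join0 joini i : symmetric (@H_adj join0 joini i).
Proof.
move=> [j|[e c]] [k|[e' c']] //=; first by rewrite orbC.
by case: e e' c c' => [] [] [] [].
Qed.

Lemma H_adj_irr join0 joini i : irreflexive (@H_adj join0 joini i).
Proof.
move=> [j|[e c]] /=; last by rewrite !eqxx.
by rewrite orbb gtn_eqF.
Qed.

Definition H_gen (join0 joini : bool) (i : nat) : sgraph :=
  SGraph (@H_adj_sym join0 joini i) (@H_adj_irr join0 joini i).

Definition H_graph (i : nat) : sgraph := H_gen false false i.
(* Reversing the body shows that the choice of the end is immaterial. *)
Definition H'_graph (i : nat) : sgraph := H_gen true false i.
Definition H''_graph (i : nat) : sgraph := H_gen true true i.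

(* [canonical C k]: C is a canonical graph of order k (one representative per
   isomorphism class). *)
Inductive canonical : sgraph -> nat -> Prop :=
| canonical_hole n of 4 <= n : canonical (cycle_graph n) n
| canonical_H i of 1 <= i : canonical (H_graph i) i.+1
| canonical_H' i of 1 <= i : canonical (H'_graph i) i.+1
| canonical_H'' i of 1 <= i : canonical (H''_graph i) i.+1.

(* Main.v *)
From mathcomp Require Import all_boot zify.
From mathcomp Require Import boolp.
Require Import Defs.

(** If the treewidth is large, then, as in the usual proof that balanced
separators yield tree decompositions, some vertex set [W] has no small balanced
separator, so that every small set [Z] leaves a component [beta Z] containing most
of [W].  Call a vertex rich if it lies in [beta Z] for every small [Z] avoiding it.

Without long holes there are many rich vertices.  Otherwise remove the set [R] of
rich vertices; each remaining vertex [v] has a small [sep v] separating it from the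
haven.  Take an induced path [p] and a component [D] of the vertices outside [R] and
the closed neighbourhood of [p], where [D] meets [beta] of the union of the
separators, with [#|D|] and then [p] minimal.  Both ends of [p] have a private
neighbour on the boundary of [D], and appending one of them shrinks [D]; so [p]
can only be stopped by its length, and then it closes up through [D] to a long hole.

Without long H-graphs, two vertices of degree at least five that are connected in an
induced subgraph have bounded distance there: the ends of a long shortest path
could be completed to an H-graph.  Hence rich vertices can be joined greedily by
short disjoint paths, giving a large clique subdivided with bounded path lengths.
By Ramsey's theorem for 4-sets of branch vertices, either adjacencies between
different paths blow up to a biclique, or there are none on a large subset of the
branch vertices, and then a cycle through these branch vertices gives a long hole. *)

Set Implicit Arguments.
Unset Strict Implicit.
Unset Printing Implicit Defensive.

(** * Ramsey's theorem *)

Lemma subseq_map_lift (A B : eqType) (f : A -> B) (t : seq B) (s : seq A) :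
  subseq t (map f s) -> exists2 u, subseq u s & t = map f u.
Proof.
case/subseqP => m sz_m ->; exists (mask m s); first exact: mask_subseq.
by rewrite map_mask.
Qed.

Lemma pigeonhole_seq (A : eqType) (C : finType) (g : A -> C) (n : nat) (s : seq A) :
  0 < n -> n * #|C| <= size s -> 0 < size s ->
  exists c, n <= count (fun x => g x == c) s.
Proof.
move=> n_gt0 le_s s_gt0; apply/existsP; apply: contraLR le_s.
rewrite negb_exists => /forallP small; rewrite -ltnNge.
have -> : size s = \sum_(c : C) count (fun x => g x == c) s.
  elim: s {s_gt0 small} => [|x s IHs] /=; first by rewrite big1.
  rewrite big_split /= -IHs (bigD1 (g x)) //= eqxx big1 ?addn0 //.
  by move=> c /negPf; rewrite eq_sym => ->.
have C_gt0 : 0 < #|C|.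
  by case: s s_gt0 {small} => // x s _; apply/card_gt0P; exists (g x).
have small' c : count (fun x => g x == c) s <= n.-1.
  by have := small c; rewrite -ltnNge; lia.
apply: (@leq_ltn_trans (\sum_(c : C) n.-1)); first exact: leq_sum.
by rewrite sum_nat_const mulnC ltn_pmul2r //; lia.
Qed.

(* The list [zs] pairs each element of the selected subsequence with the colour
   of all the [k.+1]-subsequences that start at it. *)
Lemma ramsey_leading (T : eqType) (C : finType) (k L : nat)
    (IHk : forall n, exists N, forall (f : seq T -> C) (S : seq T), N <= size S ->
      exists h c, [/\ subseq h S, size h = n &
        forall t, subseq t h -> size t = k -> f t = c]) :
  exists N, forall (f : seq T -> C) (S : seq T), N <= size S ->
    exists zs : seq (T * C), [/\ subseq (unzip1 zs) S, size zs = L &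
      forall z t, subseq (z :: t) zs -> size t = k -> f (z.1 :: unzip1 t) = z.2].
Proof.
elim: L => [|L [N IHL]]; first by exists 0 => f S _; exists [::]; split; rewrite ?sub0seq.
(* The head [x] is committed first. In the rest, [M] elements suffice to find [N] of them on which
   [x] followed by any [k] has one colour; the selection goes on there. *)
have [M IHM] := IHk N; exists M.+1 => f [|x S] //= ltMS.
have [h [c [hS sz_h hc]]] := IHM (fun t => f (x :: t)) S ltMS.
have [zs [zs_h sz_zs zsP]] := IHL f h (eq_leq (esym sz_h)).
exists ((x, c) :: zs); split=> /=; last 2 first.
- by rewrite sz_zs.
- move=> z t; case: eqP => [-> /= sub_t sz_t | _]; last exact: zsP.
  apply: hc; last by rewrite size_map.
  by apply: subseq_trans zs_h; apply: map_subseq.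
by rewrite eqxx; apply: subseq_trans hS.
Qed.

(** Along the list from [ramsey_leading] the colour of a [k.+1]-subsequence depends on its first
    element only, so the pigeonhole principle on the attached colours finishes. *)
Theorem ramsey (T : eqType) (C : finType) (c0 : C) (k n : nat) :
  exists N, forall (f : seq T -> C) (S : seq T), N <= size S ->
    exists h c, [/\ subseq h S, size h = n &
      forall t, subseq t h -> size t = k -> f t = c].
Proof.
elim: k n => [|k IHk] n.
  exists n => f S leS; exists (take n S), (f [::]); split.
  - exact: take_subseq.
  - exact: size_takel.
  - by move=> t _ /size0nil ->.
(* Asking for [n.+1] equal colours keeps the list non-empty even for [n = 0]. *)
have [N lead] := ramsey_leading (n.+1 * #|C|) IHk; exists N => f S leS.
have [zs [zsS sz_zs zsP]] := lead f S leS.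
have C_gt0 : 0 < #|C| by apply/card_gt0P; exists c0.
have [] := @pigeonhole_seq _ _ (fun z : T * C => z.2) n.+1 zs; rewrite ?sz_zs //.
  by rewrite muln_gt0.
move=> c ltn_c; pose ws := take n [seq z <- zs | z.2 == c].
have ws_zs : subseq ws zs.
  by apply: subseq_trans (take_subseq _ _) (filter_subseq _ _).
have sz_ws : size ws = n by rewrite size_takel // size_filter ltnW.
exists (unzip1 ws), c; split; last 1 first.
- move=> t /subseq_map_lift [u uws ->]; rewrite size_map.
  case: u uws => // z u uws [sz_u] /=; rewrite (zsP z u) //.
    have: z \in ws by apply: (mem_subseq uws); rewrite inE eqxx.
    by move/mem_take; rewrite mem_filter => /andP[/eqP].
  exact: subseq_trans uws ws_zs.
- by apply: subseq_trans zsS; apply: map_subseq.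
- by rewrite size_map.
Qed.

(** * Subsets and connectivity within a vertex set *)

Lemma card_between (T : finType) (A B : {set T}) (c : nat) :
  A \subset B -> #|A| <= c -> c <= #|B| ->
  exists D : {set T}, [/\ A \subset D, D \subset B & #|D| = c].
Proof.
move=> AB; elim: c => [|c IHc] leAc lecB.
  by exists A; split=> //; apply/eqP; rewrite -leqn0.
have [leA | ltA] := leqP #|A| c; last first.
  by exists A; split=> //; apply/eqP; rewrite eqn_leq leAc.
have [D [AD DB cD]] := IHc leA (ltnW lecB).
have /subsetPn[x xB xD] : ~~ (B \subset D).
  by apply: contraL lecB => /subset_leq_card; rewrite cD -ltnNge.
exists (x |: D); split.
- exact: subset_trans AD (subsetUr _ _).
- by rewrite subUset sub1set xB.
- by rewrite cardsU1 xD cD.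
Qed.

Lemma bigcup_seq_sub (I : Type) (T : finType) (l : seq I) (P : pred I)
    (F : I -> {set T}) (B : {set T}) :
  (forall i, P i -> F i \subset B) -> \bigcup_(i <- l | P i) F i \subset B.
Proof.
move=> FB; elim/big_ind: _ => [|X Y XB YB|//]; first exact: sub0set.
by rewrite subUset XB.
Qed.

Definition adj_in (G : sgraph) (A : {set G}) : rel G :=
  [rel x y | [&& adj x y, x \in A & y \in A]].

(** For [x] outside [A] this is the singleton of [x], which is why the facts below assume
    [x \in A]. *)
Definition component (G : sgraph) (A : {set G}) (x : G) : {set G} :=
  [set y | connect (adj_in A) x y].

Lemma adj_in_sym (G : sgraph) (A : {set G}) : symmetric (adj_in A).
Proof. by move=> x y; rewrite /adj_in /= adj_sym [(x \in A) && _]andbC. Qed.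

Lemma connect_adj_in_sym (G : sgraph) (A : {set G}) :
  connect_sym (adj_in A).
Proof. exact/sym_connect_sym/adj_in_sym. Qed.

Lemma connect_adj_inS (G : sgraph) (A B : {set G}) (x y : G) :
  A \subset B -> connect (adj_in A) x y -> connect (adj_in B) x y.
Proof.
move=> AB; apply: connect_sub => u v /and3P[uv uA vA].
by apply: connect1; rewrite /adj_in /= uv !(subsetP AB).
Qed.

Lemma connect_adj_in_mem (G : sgraph) (A D : {set G}) (x y : G) :
  (forall u v, u \in D -> v \in A -> adj u v -> v \in D) ->
  x \in D -> connect (adj_in A) x y -> y \in D.
Proof.
move=> closedD + /connectP[p + ->]; elim: p x => //= z p IHp x xD.
by case/andP=> /and3P[xz _ zA]; apply: IHp; apply: closedD xz.
Qed.

(** * Assembling tree decompositions *)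

(* [S] is the set of bags of a tree decomposition of the subgraph induced on [A],
   built by hanging each new bag [B] below an earlier bag [B']. *)
Inductive grown (G : sgraph) (b : nat) : {set G} -> {set {set G}} -> Prop :=
| grown_root (B : {set G}) of #|B| <= b : grown b B [set B]
| grown_leaf (A : {set G}) (S : {set {set G}}) (B B' : {set G})
    of grown b A S & B' \in S & #|B| <= b
    & A :&: B \subset B'
    & (forall u v, u \in A :\: B -> v \in B :\: A -> ~~ adj u v) :
    grown b (A :|: B) (B |: S).

Lemma grown_sub (G : sgraph) b (A : {set G}) S B :
  grown b A S -> B \in S -> B \subset A.
Proof.
elim=> [{}A _|{}A {}S B1 B2 _ IH _ _ _ _]; first by rewrite inE => /eqP->.
case/setU1P => [->|/IH BA]; first exact: subsetUr.
exact: subset_trans BA (subsetUl _ _).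
Qed.

(** The tree is encoded by parents of smaller index. [id_run] is the connectivity axiom in this
    form: from any bag with [v], parents containing [v] lead to the bag of least index with [v]. *)
Record indexed_decomposition (G : sgraph) (b : nat) (A : {set G}) (n : nat)
    (par : nat -> nat) (bag : nat -> {set G}) : Prop := IndexedDecomposition {
  id_par : forall i, 0 < i < n -> par i < i;
  id_size : forall i, i < n -> #|bag i| <= b;
  id_vertex : forall v, v \in A -> exists2 i, i < n & v \in bag i;
  id_sub : forall i, i < n -> bag i \subset A;
  id_edge : forall u v, u \in A -> v \in A -> adj u v ->
    exists2 i, i < n & (u \in bag i) && (v \in bag i);
  id_run : forall i j v, j < i < n -> v \in bag i -> v \in bag j ->
    v \in bag (par i) }.

Lemma grown_indexed (G : sgraph) b (A : {set G}) S : grown b A S ->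
  exists n par bag, [/\ 0 < n, indexed_decomposition b A n par bag &
    forall B, B \in S -> exists2 i, i < n & bag i = B].
Proof.
elim=> [{}A leA|{}A {}S B B' _ [n [par [bag [n_gt0 dec inS]]]] B'S leB AB nadj].
  exists 1, id, (fun=> A); split=> //.
    split=> //; first by [case=> [|[]]].
    - by exists 0.
    - by move=> u v uA vA _; exists 0; rewrite ?uA.
    by move=> ? /set1P->; exists 0.
have [p ltpn bagp] := inS _ B'S.
pose bag' i := if i == n then B else bag i.
pose par' i := if i == n then p else par i.
have bag'_lt i : i < n -> bag' i = bag i by rewrite /bag' ltn_neqAle => /andP[/negPf->].
have bag'_n : bag' n = B by rewrite /bag' eqxx.
exists n.+1, par', bag'; split=> //.
  split.
  - move=> i /andP[i_gt0]; rewrite ltnS leq_eqVlt /par' => /predU1P[->|ltin].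
      by rewrite eqxx.
    by rewrite ltn_eqF // (id_par dec) ?i_gt0.
  - move=> i; rewrite ltnS leq_eqVlt => /predU1P[->|ltin]; first by rewrite bag'_n.
    by rewrite bag'_lt ?(id_size dec).
  - move=> v; case/setUP => [/(id_vertex dec)[i ltin vi]|vB].
      by exists i; rewrite ?bag'_lt // ltnW.
    by exists n; rewrite ?bag'_n.
  - move=> i; rewrite ltnS leq_eqVlt => /predU1P[->|ltin].
      by rewrite bag'_n subsetUr.
    by rewrite bag'_lt // subsetU // (id_sub dec).
  - have bothB u v : u \in B -> v \in B ->
        exists2 i, i < n.+1 & (u \in bag' i) && (v \in bag' i).
      by move=> uB vB; exists n; rewrite ?bag'_n ?uB.
    have bothA u v : u \in A -> v \in A -> adj u v ->
        exists2 i, i < n.+1 & (u \in bag' i) && (v \in bag' i).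
      move=> uA vA /(id_edge dec uA vA)[i ltin uvi].
      by exists i; rewrite ?bag'_lt // ltnW.
    move=> u v; rewrite !inE => uAB vAB uv.
    have [uB|uB] := boolP (u \in B); have [vB|vB] := boolP (v \in B).
    + exact: bothB.
    + rewrite (negPf vB) orbF in vAB; have [uA|uA] := boolP (u \in A).
        exact: bothA.
      by have := nadj v u; rewrite !inE vB vAB uA uB adj_sym uv => /(_ isT isT).
    + rewrite (negPf uB) orbF in uAB; have [vA|vA] := boolP (v \in A).
        exact: bothA.
      by have := nadj u v; rewrite !inE uB vB vA uAB uv => /(_ isT isT).
    + by apply: bothA => //; [move: uAB | move: vAB]; rewrite ?(negPf uB) ?(negPf vB) orbF.
  - move=> i j v /andP[ltji]; rewrite ltnS leq_eqVlt => /predU1P[eqin|ltin].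
      rewrite eqin bag'_n /par' eqxx bag'_lt -?eqin // => vB vj.
      rewrite bag'_lt // bagp; apply: (subsetP AB); rewrite inE vB andbT.
      by apply: (subsetP (id_sub dec (_ : j < n))) => //; rewrite -eqin.
    have ltjn := ltn_trans ltji ltin.
    have ltpi : par i < i by apply: (id_par dec); lia.
    rewrite /par' (ltn_eqF ltin) !bag'_lt //; last exact: ltn_trans ltin.
    by apply: (id_run dec); rewrite ltji.
move=> B1 /setU1P[->|/inS[i ltin <-]]; first by exists n.
by exists i; rewrite ?bag'_lt // ltnW.
Qed.

(** Comparing [i] and [j] makes the relation irreflexive for an arbitrary function [par]. *)
Definition parent_adj (n : nat) (par : nat -> nat) : rel 'I_n :=
  fun i j => [&& 0 < i, par i == j & j < i] || [&& 0 < j, par j == i & i < j].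

Lemma parent_adj_sym n par : symmetric (@parent_adj n par).
Proof. by move=> i j; rewrite /parent_adj orbC. Qed.

Lemma parent_adj_irr n par : irreflexive (@parent_adj n par).
Proof. by move=> i; rewrite /parent_adj ltnn !andbF. Qed.

Definition parent_graph (n : nat) (par : nat -> nat) : sgraph :=
  SGraph (@parent_adj_sym n par) (@parent_adj_irr n par).

(** Parents lead down to 0, which gives connectivity. On a cycle, both neighbours of the vertex of
    largest index would be its parent. *)
Lemma parent_graph_tree n par :
  0 < n -> (forall i, 0 < i < n -> par i < i) -> is_tree (parent_graph n par).
Proof.
move=> n_gt0 par_lt; split; first by rewrite card_ord.
- have to0 (i : parent_graph n par) : connect (@adj _) i (Ordinal n_gt0).
    have [m] := ubnP (val i); elim: m i => // m IHm [[|i] ltin] /= ltim.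
      by rewrite (bool_irrelevance ltin n_gt0).
    have ltp : par i.+1 < i.+1 by apply: par_lt.
    have ltpn : par i.+1 < n := ltn_trans ltp ltin.
    apply: (@connect_trans _ _ (Ordinal ltpn)); last by apply: IHm => /=; lia.
    by apply: connect1; rewrite /= /parent_adj /= eqxx ltp.
  move=> x y; apply: connect_trans (to0 x) _.
  by rewrite (sym_connect_sym (@adj_sym _)); apply: to0.
move=> c; case: c => // x0 c0; set c := x0 :: c0 => c_cycle.
rewrite leqNgt; apply/negP => c_gt2.
pose x : 'I_n := [arg max_(x > x0 in c) (val x)].
have [xc x_max] : x \in c /\ forall y, y \in c -> val y <= val x.
  by rewrite /x; case: arg_maxnP => //; rewrite inE eqxx.
have nbr_par (y : parent_graph n par) : y \in c -> adj (y : parent_graph n par) x -> val y = par x.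
  move=> /x_max leyx /= /orP[/and3P[_ /eqP _ ltxy]|/and3P[_ /eqP -> //]].
  by case/idPn: ltxy; rewrite -leqNgt.
have [k c' def_c] := rot_to xc.
have c'c z : z \in x :: c' -> z \in c by rewrite -def_c mem_rot.
have: ucycle (@adj (parent_graph n par)) (x :: c') by rewrite -def_c rot_ucycle.
have: size (x :: c') > 2 by rewrite -def_c size_rot.
case: c' {def_c} c'c => // y c' c'c; case: (lastP c') c'c => // {}c' z c'c _ /andP[].
rewrite /cycle rcons_path /= last_rcons => /andP[/andP[xy _] zx] /and3P[_ yNz _].
case/negP: yNz; rewrite mem_rcons inE.
suff -> : y = z by rewrite eqxx.
have zc : z \in c by apply: c'c; rewrite !inE mem_rcons inE eqxx !orbT.
have yc : y \in c by apply: c'c; rewrite !inE eqxx orbT.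
by apply: val_inj; rewrite (nbr_par _ zc zx) (nbr_par y yc) // adj_sym.
Qed.

Lemma grown_treewidth (G : sgraph) b S : grown b [set: G] S -> treewidth G <= b.-1.
Proof.
case/grown_indexed => n [par [bag [n_gt0 dec _]]].
pose bagT (i : parent_graph n par) := bag (val i).
have [_ /(_ (width bagT))] := treewidthP G.
have le_width : width bagT <= b.-1.
  rewrite /width; suff: \max_(t : parent_graph n par) #|bagT t| <= b by lia.
  by apply/bigmax_leqP => i _; exact: (id_size dec (ltn_ord i)).
move/(_ _)/leq_trans; apply=> //; exists (parent_graph n par), bagT; split=> //.
split.
- by apply: parent_graph_tree => // i; apply: (id_par dec).
- by move=> v; have [//|i ltin vi] := id_vertex dec (v := v); exists (Ordinal ltin).
- move=> u v uv; have [//|//|i ltin uvi] := id_edge dec (u := u) (v := v) _ _ uv.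
  by exists (Ordinal ltin).
move=> v s t vs vt; set e := (X in connect X _ _).
have e_sym : connect_sym e.
  by apply: sym_connect_sym => i j; rewrite /e /= parent_adj_sym [(v \in bagT i) && _]andbC.
have ex_r : exists i, (i < n) && (v \in bag i) by exists (val s); rewrite ltn_ord.
case: (ex_minnP ex_r) => r /andP[ltrn vr] r_min.
have to_r (i : parent_graph n par) : v \in bagT i -> connect e i (Ordinal ltrn).
  have [m] := ubnP (val i); elim: m i => // m IHm [i ltin] /= ltim vi.
  have: r <= i by apply: r_min; rewrite ltin.
  rewrite leq_eqVlt => /predU1P[eqri|ltri].
    by rewrite (_ : Ordinal ltin = Ordinal ltrn) //; apply: val_inj.
  have ltp : par i < i by apply: (id_par dec); lia.
  have ltpn : par i < n := ltn_trans ltp ltin.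
  have vp : v \in bag (par i) by apply: (id_run dec (i := i) (j := r)); rewrite ?ltri.
  apply: (@connect_trans _ _ (Ordinal ltpn)); last by apply: IHm => //=; lia.
  apply: connect1; rewrite /e /= /parent_adj /= eqxx ltp vi vp !andbT.
  by apply/orP; left; lia.
apply: connect_trans (to_r s vs) _; rewrite e_sym; exact: to_r.
Qed.

(** Induction on the part [A] still to be decomposed, which meets the finished part [A0] within the
    bag [W]. A balanced separator [Z] of a set containing [W] gives one new bag; below it, each
    component outside [Z] is treated recursively, with at most [K] vertices from either set as
    interface. *)
Lemma grow_all (G : sgraph) (K : nat) :
  (forall W : {set G}, #|W| = (2 * K).+1 -> exists2 Z : {set G}, #|Z| <= K &
     forall x, x \notin Z -> #|W :&: component (~: Z) x| <= K) ->
  forall (A W A0 : {set G}) S,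
    #|W| <= (2 * K).+1 -> W \subset A -> grown (3 * K).+1 A0 S -> W \in S ->
    A :&: A0 \subset W ->
    (forall u v, u \in A :\: W -> v \in A0 :\: W -> ~~ adj u v) ->
    exists2 S' : {set {set G}}, S \subset S' & grown (3 * K).+1 (A0 :|: A) S'.
Proof.
move=> sepG A; have [m] := ubnP #|A|; elim: m A => // m IHm A ltAm W A0 S.
move=> leW WA grA0 WS AA0 nadj.
have le23 : 2 * K <= (3 * K).+1 by lia.
have WA0 := grown_sub grA0 WS.
have [leA|ltA] := leqP #|A| (3 * K).+1.
  exists (A |: S); first exact: subsetUr.
  apply: grown_leaf grA0 WS leA _ _; first by rewrite setIC.
  move=> u v; rewrite !inE => /andP[uA uA0] /andP[vA0 vA].
  rewrite adj_sym; apply: nadj; rewrite !inE ?uA0 ?vA andbT.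
  - by apply: contra vA0; apply: subsetP.
  - by apply: contra uA; apply: subsetP.
(* Padding [W] to exactly [(2 * K).+1] vertices later makes the recursive pieces smaller than
   [A]. *)
have [|Wp [WWp WpA cardWp]] := card_between WA leW; first by lia.
have [Z leZ Zsep] := sepG Wp cardWp.
pose B := Wp :|: (Z :&: A).
have BA : B \subset A by rewrite subUset WpA subsetIr.
have WpB : Wp \subset B by exact: subsetUl.
have leB : #|B| <= (3 * K).+1.
  have := cardsUI Wp (Z :&: A); have := subset_leq_card (subsetIl Z A).
  rewrite -/B; lia.
have grB : grown (3 * K).+1 (A0 :|: B) (B |: S).
  apply: grown_leaf grA0 WS leB _ _.
    by apply: subset_trans AA0; rewrite setIC setSI.
  move=> u v; rewrite !inE => /andP[uB uA0] /andP[vA0 vB].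
  rewrite adj_sym; apply: nadj; rewrite !inE.
    rewrite (subsetP BA) ?inE // andbT.
    by apply: contra vA0; apply: subsetP.
  by rewrite uA0 andbT; apply: contra uB => uW; rewrite (subsetP WWp).
pose C x := component (~: Z) x.
(* [U l] is the part decomposed once the components of the vertices in [l] have been treated; a
   component met again changes nothing. *)
pose U l := A0 :|: B :|: \bigcup_(x <- l | x \notin Z) (C x :&: A).
have step l : exists2 S' : {set {set G}}, B |: S \subset S' & grown (3 * K).+1 (U l) S'.
  elim: l => [|x l [S' SS' grU]].
    by exists (B |: S); rewrite // /U big_nil setU0.
  rewrite /U big_cons; case: ifP => [xZ|_]; last by exists S'.
  have [sub|Nsub] := boolP (C x :&: A \subset U l).
    exists S' => //; rewrite setUCA -/(U l).
    by move/setUidPr: sub => ->.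
  have UA : U l \subset A0 :|: A.
    rewrite /U subUset setUS //=; apply: bigcup_seq_sub => y.
    by rewrite subsetU // subsetIr orbT.
  have CU : C x :&: A :&: U l \subset B.
    apply/subsetP => z /setIP[/setIP[zC zA]].
    case/setUP=> [/setUP[zA0|//]|].
      by apply: (subsetP WpB); apply/(subsetP WWp)/(subsetP AA0); rewrite inE zA.
    elim: l Nsub {UA SS' grU} => [|y l IHl]; first by rewrite big_nil inE.
    rewrite /U !big_cons; case: ifP => // yZ Nsub.
    case/setUP=> [/setIP[yz _]|]; last first.
      apply: IHl; apply: contra Nsub => /subset_trans; apply.
      by rewrite setUCA subsetUr.
    case/negP: Nsub; rewrite setUCA; apply: subset_trans (subsetUl _ _).
    apply: setSI; apply/subsetP => w; move: zC yz; rewrite !inE => xz yz xw.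
    by apply: connect_trans yz _;
      rewrite connect_adj_in_sym (connect_trans _ xz) // connect_adj_in_sym.
  pose AC := (C x :&: A) :|: (Z :&: A); pose WC := (Wp :&: C x) :|: (Z :&: A).
  have WCB : WC \subset B by rewrite setSU // subsetIl.
  have BU : B \subset U l by rewrite /U -setUA setUCA subsetUl.
  have ZAB : Z :&: A \subset B by apply: subsetUr.
  have leWC : #|WC| <= 2 * K.
    apply: leq_trans (leq_card_setU _ _) _; rewrite mul2n -addnn leq_add //.
      exact: Zsep.
    exact: leq_trans (subset_leq_card (subsetIl Z A)) leZ.
  have BS' : B \in S' by apply: (subsetP SS'); rewrite setU11.
  (* [WC] lies within [B]; it becomes a bag of its own to serve as the interface of the recursive
     call. *)
  have grWC : grown (3 * K).+1 (U l) (WC |: S').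
    have eqU : U l :|: WC = U l by apply/setUidPl; apply: subset_trans BU.
    rewrite -{1}eqU.
    apply: grown_leaf grU BS' _ _ _; first exact: leq_trans leWC le23.
      exact: subset_trans (subsetIr _ _) WCB.
    move=> u v _ /setDP[vWC /negP[]].
    exact: (subsetP (subset_trans WCB BU)).
  have ACA : AC \subset A by rewrite subUset !subsetIr.
  have ACU : AC :&: U l \subset WC.
    apply/subsetP => z /setIP[/setUP[zCA|zZA] zU]; last by rewrite inE zZA orbT.
    have := subsetP CU z; rewrite inE zCA => /(_ zU); rewrite !in_setU => /orP[zW|->].
      by move: zCA; rewrite !inE zW => /andP[->].
    by rewrite orbT.
  have [|||||||S'' sub'' gr''] := IHm AC _ WC (U l) (WC |: S').
  (* If the piece were all of [A], then [Wp] would lie in [WC], which has at most [2 * K]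
     elements. *)
  - rewrite (leq_trans _ (_ : #|A| <= m)) //; apply: proper_card.
    rewrite properE ACA; apply/negP => AAC; suff: #|Wp| <= 2 * K by rewrite cardWp ltnn.
    apply: leq_trans leWC; apply: subset_leq_card; apply/subsetP => z zWp.
    have /(subsetP AAC) : z \in A by apply: (subsetP WpA).
    by rewrite !inE zWp => /orP[/andP[->]|->]; rewrite ?orbT.
  - exact: leq_trans leWC (leqnSn _).
  - by rewrite setSU // setIC setIS.
  - exact: grWC.
  - exact: setU11.
  - exact: ACU.
  - move=> u v /setDP[uAC uWC] /setDP[vU vWC]; apply/negP => uv.
    have uA := subsetP ACA u uAC.
    have uZ : u \notin Z by apply: contra uWC => uZ; rewrite !inE uZ uA orbT.
    have uC : u \in C x by move: uAC; rewrite !inE (negPf uZ) /= orbF => /andP[].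
    have uWp : u \notin Wp by apply: contra uWC => uWp; rewrite in_setU in_setI uWp uC.
    have [vA|vA] := boolP (v \in A).
      have vZ : v \notin Z by apply: contra vWC => vZ; rewrite !inE vZ vA orbT.
      have vC : v \in C x.
        move: uC; rewrite !inE => /connect_trans; apply; apply: connect1.
        by rewrite /adj_in /= uv !inE uZ.
      case/negP: vWC; apply: (subsetP ACU).
      by rewrite in_setI vU andbT !in_setU in_setI vC vA.
    have vA0 : v \in A0.
      by move/(subsetP UA): vU; rewrite !inE (negPf vA) orbF.
    have := nadj u v; rewrite !inE uA vA0 uv.
    have -> : u \notin W by apply: contra uWp; apply: subsetP.
    have -> : v \notin W by apply: contra vA; apply: subsetP.
    by move/(_ isT isT).
  exists S''; first exact: subset_trans SS' (subset_trans (subsetUr _ _) sub'').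
  rewrite setUCA -/(U l); suff -> : C x :&: A :|: U l = U l :|: AC by [].
  rewrite setUC /AC [_ :|: (Z :&: A)]setUC setUA; congr (_ :|: _).
  by apply/esym/setUidPl; apply: subset_trans ZAB BU.
have [S' SS' gr] := step (enum A).
exists S'; first exact: subset_trans (subsetUr _ _) SS'.
suff <- : U (enum A) = A0 :|: A by [].
apply/eqP; rewrite eqEsubset; apply/andP; split.
  rewrite /U subUset setUS //=; apply: bigcup_seq_sub => y.
  by rewrite subsetU // subsetIr orbT.
rewrite subUset /U -setUA subsetUl /=; apply/subsetP => x xA; rewrite !in_setU.
have [xZ|xZ] := boolP (x \in Z); first by rewrite in_setI xZ xA !orbT.
rewrite (_ : x \in \bigcup_(_ <- _ | _) _) ?orbT //.
rewrite (big_rem x) ?mem_enum //= xZ in_setU in_setI xA inE.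
by rewrite connect0.
Qed.

(** Otherwise [grow_all], started from an empty bag, would decompose the whole graph into bags of at
    most [(3 * K).+1] vertices. More than [K] vertices of [W] are a majority. *)
Lemma treewidth_unseparated (G : sgraph) (K : nat) : 3 * K < treewidth G ->
  exists2 W : {set G}, #|W| = (2 * K).+1 &
    forall Z : {set G}, #|Z| <= K ->
      exists2 x, x \notin Z & K < #|W :&: component (~: Z) x|.
Proof.
move=> lt_tw; apply: contrapT => noW; move: lt_tw; apply/negP; rewrite -leqNgt.
have [|||||||S _] := @grow_all G K _ [set: G] set0 set0 [set set0].
- move=> W cardW; apply: contrapT => noZ; apply: noW; exists W => // Z leZ.
  apply: contrapT => nox; apply: noZ; exists Z => // x xZ.
  by rewrite leqNgt; apply/negP => ltK; apply: nox; exists x.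
- by rewrite cards0.
- exact: sub0set.
- by apply: grown_root; rewrite cards0.
- exact: set11.
- by rewrite setI0 sub0set.
- by move=> u v _; rewrite !inE.
by rewrite set0U => /grown_treewidth.
Qed.

(** * Induced paths and holes *)

(* Walks and paths are functions on [nat] of which only the values up to [n] matter:
   there are [n] edges and [n.+1] vertices. *)
Definition walk (G : sgraph) (A : {set G}) (w : nat -> G) (n : nat) : Prop :=
  (forall i, i <= n -> w i \in A) /\ (forall i, i < n -> adj (w i) (w i.+1)).

Definition induced_path (G : sgraph) (p : nat -> G) (n : nat) : Prop :=
  (forall i j, i <= n -> j <= n -> p i = p j -> i = j) /\
  (forall i j, i <= n -> j <= n -> adj (p i) (p j) = (i.+1 == j) || (j.+1 == i)).

Lemma walk_shortcut (G : sgraph) (A : {set G}) p n i d :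
  walk A p n -> i.+1 + d <= n -> adj (p i) (p (i.+1 + d)) ->
  walk A (fun k => if k <= i then p k else p (k + d)) (n - d).
Proof.
move=> [pA padj] le_n pij; split=> k lek.
  by case: leqP => _; apply: pA; lia.
have [ltki|] := leqP k.+1 i; first by rewrite ltnW // padj //; lia.
rewrite ltnS leq_eqVlt => /predU1P[<-|ltik]; first by rewrite leqnn.
by rewrite leqNgt ltik /= addSn padj //; lia.
Qed.

Lemma connect_walk (G : sgraph) (A : {set G}) x y :
  x \in A -> connect (adj_in A) x y ->
  exists n w, [/\ walk A w n, w 0 = x & w n = y].
Proof.
move=> xA /connectP[s + ->] {y}; elim: s x xA => [|z s IHs] x xA /=.
  by move=> _; exists 0, (fun=> x).
case/andP=> /and3P[xz _ zA] /(IHs z zA)[n [w [[wA wadj] w0 wn]]].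
exists n.+1, (fun i => if i is j.+1 then w j else x); split=> //.
by split=> [[|i] //|[|i] lti]; [exact: wA | rewrite w0 | exact: wadj].
Qed.

(** A shortest walk has neither chords nor repetitions, as both allow shortcuts. Minimality is kept
    in the conclusion for the H-graph argument. *)
Lemma geodesic (G : sgraph) (A : {set G}) x y :
  x \in A -> connect (adj_in A) x y ->
  exists n p, [/\ p 0 = x, p n = y, forall i, i <= n -> p i \in A,
    induced_path p n &
    forall m w, walk A w m -> w 0 = x -> w m = y -> n <= m].
Proof.
move=> xA /(connect_walk xA) exw.
pose P n := `[< exists w, [/\ walk A w n, w 0 = x & w n = y] >].
have exP : exists n, P n by case: exw => n wn; exists n; apply/asboolP.
case: (ex_minnP exP) => n /asboolP[p [pwalk p0 pn]] n_min.
have short m w : walk A w m -> w 0 = x -> w m = y -> n <= m.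
  by move=> ww w0 wm; apply: n_min; apply/asboolP; exists w.
have [pA padj] := pwalk.
have far i d : i.+1 + d <= n -> adj (p i) (p (i.+1 + d)) -> d = 0.
  move=> le_n pij; have := short _ _ (walk_shortcut pwalk le_n pij).
  rewrite /= p0 ifF; last by lia.
  by rewrite subnK; [move/(_ erefl pn); lia | lia].
(* A repetition [p i = p j] gives the chord from [p i] to [p j.+1] or, for [j = n], a walk that can
   stop at [i]. *)
have inj i j : i < j -> j <= n -> p i <> p j.
  move=> ltij lejn eqp; have [ltjn|] := ltnP j n.
    have := far i (j - i); rewrite (_ : i.+1 + (j - i) = j.+1); last by lia.
    by rewrite eqp padj // => /(_ ltjn isT); lia.
  move=> lenj; have eqj : j = n by lia.
  have wi : walk A p i by split=> k lek; [apply: pA | apply: padj]; lia.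
  by have := short i p wi p0; rewrite eqp eqj => /(_ pn); lia.
have sadj i j : i < j -> j <= n -> adj (p i) (p j) = (i.+1 == j).
  move=> ltij lejn; apply/idP/eqP => [pij|<-]; last by apply: padj; lia.
  have := far i (j - i.+1); rewrite subnKC // => /(_ lejn pij); lia.
exists n, p; split=> //; split=> i j lei lej.
  have [ltij /(inj _ _ ltij lej)//|ltji /esym /(inj _ _ ltji lei)//|//] := ltngtP i j.
have [ltij|ltji|->] := ltngtP i j.
- by rewrite sadj // [j.+1 == i]gtn_eqF ?orbF //; lia.
- by rewrite adj_sym sadj // [i.+1 == j]gtn_eqF //; lia.
- by rewrite adj_irr; lia.
Qed.

Lemma induced_path_rcons (G : sgraph) (p : nat -> G) n b :
  induced_path p n -> (forall i, i <= n -> p i != b) ->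
  adj (p n) b -> (forall i, i < n -> ~~ adj (p i) b) ->
  induced_path (fun i => if i <= n then p i else b) n.+1.
Proof.
move=> [p_inj p_adj] pNb nb Nb.
have adj_b i : i <= n -> adj (p i) b = (i == n).
  by rewrite leq_eqVlt => /predU1P[->|lti]; rewrite ?eqxx // (negPf (Nb _ lti)) ltn_eqF.
split=> i j lei lej; case: leqP => lti; case: leqP => ltj.
- exact: p_inj.
- by move/eqP; rewrite (negPf (pNb _ lti)).
- by move/esym/eqP; rewrite (negPf (pNb _ ltj)).
- by lia.
- exact: p_adj.
- by rewrite adj_b //; lia.
- by rewrite adj_sym adj_b //; lia.
- by rewrite adj_irr; lia.
Qed.

Definition has_hole (s : nat) (G : sgraph) : Prop :=
  exists n, [/\ 4 <= n, s <= n & induced_subgraph (cycle_graph n) G].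

Lemma cycle_induced (G : sgraph) (c : nat -> G) (n : nat) : 4 <= n ->
  (forall i j, i < n -> j < n -> c i = c j -> i = j) ->
  (forall i j, i < j -> j < n ->
     adj (c i) (c j) = (i.+1 == j) || (i == 0) && (j.+1 == n)) ->
  induced_subgraph (cycle_graph n) G.
Proof.
move=> n_ge4 c_inj c_adj; exists (fun i : 'I_n => c i).
  by move=> i j /c_inj eqij; apply: val_inj; apply: eqij.
have S_lt i : i < n -> i.+1 %% n = if i.+1 == n then 0 else i.+1.
  move=> lti; case: eqP => [->|neq]; first by rewrite modnn.
  by rewrite modn_small //; lia.
have c_adj' (i j : 'I_n) : i < j -> adj (c i) (c j) = cycle_adj i j.
  move=> ltij; rewrite c_adj // /cycle_adj -!val_eqE /= !S_lt //.
  by have := ltn_ord j; case: ifP; case: ifP; lia.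
move=> i j; change (adj (c i) (c j) = cycle_adj i j).
have [ltij|ltji|eqij] := ltngtP i j; first exact: c_adj'.
- by rewrite adj_sym cycle_adj_sym c_adj'.
- by rewrite (val_inj eqij) adj_irr cycle_adj_irr.
Qed.

(** A shortest path [r] through [Y] between the ends of [q] closes it up. Inner vertices of [q] have
    no neighbours in [Y], and [r] has at least two edges because the ends of [q] are distinct and
    non-adjacent. *)
Lemma hole_close (G : sgraph) (q : nat -> G) (n : nat) (Y : {set G}) (a b : G) :
  1 < n -> induced_path q n ->
  {in Y &, forall x y, connect (adj_in Y) x y} ->
  (forall i, i <= n -> q i \notin Y) ->
  (forall i y, 0 < i < n -> y \in Y -> ~~ adj (q i) y) ->
  a \in Y -> adj (q 0) a -> b \in Y -> adj (q n) b ->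
  has_hole n.+2 G.
Proof.
move=> n_gt1 [q_inj q_adj] Y_conn qY q_anti aY qa bY qb.
pose A := q 0 |: (q n |: Y).
have q0A : q 0 \in A by rewrite setU11.
have YA : Y \subset A by rewrite /A setUA subsetUr.
have conn : connect (adj_in A) (q 0) (q n).
  apply: (@connect_trans _ _ a).
    by apply: connect1; rewrite /adj_in /= qa q0A (subsetP YA).
  apply: (@connect_trans _ _ b); first by apply: connect_adj_inS YA _; apply: Y_conn.
  by apply: connect1; rewrite /adj_in /= adj_sym qb (subsetP YA) // !inE eqxx orbT.
have [m [r [r0 rm rA [r_inj r_adj] _]]] := geodesic q0A conn.
have m_gt1 : 1 < m.
  case: m rm r_adj {r_inj rA} => [|[|m]] // rm r_adj.
    by have := q_inj 0 n isT (leqnn _); rewrite -r0 -rm => /(_ erefl); lia.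
  have := q_adj 0 n isT (leqnn _); rewrite -r0 -rm r_adj //=; lia.
have rY j : 0 < j < m -> r j \in Y.
  move=> ltj; have: r j \in A by apply: rA; lia.
  rewrite !inE -r0 -rm => /or3P[/eqP/r_inj|/eqP/r_inj|//]; lia.
have qr_adj i j : i <= n -> 0 < j < m ->
    adj (q i) (r j) = (i == 0) && (j == 1) || (i == n) && (j.+1 == m).
  move=> lei ltj; have [->|i_gt0] := posnP i; first by rewrite -r0 r_adj //; lia.
  move: lei; rewrite leq_eqVlt => /predU1P[->|lti].
    by rewrite -rm r_adj //; lia.
  by rewrite (negPf (q_anti _ _ _ (rY _ ltj))); lia.
exists (n + m); split; [lia | lia |].
(* [q] is run forwards and then [r] backwards, the common ends being listed once. *)
pose c i := if i <= n then q i else r (n + m - i).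
apply: (@cycle_induced _ c); first by lia.
  move=> i j lti ltj; rewrite /c; case: leqP => lei; case: leqP => lej.
  - exact: q_inj.
  - by move=> eqc; have := qY i lei; rewrite eqc rY //; lia.
  - by move=> eqc; have := qY j lej; rewrite -eqc rY //; lia.
  - by move/r_inj; lia.
move=> i j ltij ltj; rewrite /c; case: leqP => lei; case: leqP => lej; try lia.
- by rewrite q_adj //; lia.
- by rewrite qr_adj //; lia.
- by rewrite r_adj //; lia.
Qed.

(** * Havens and rich vertices *)

(** A haven as in graph minor theory, with [beta] made total: for more than [K] vertices in [Z],
    [beta Z] may be empty. Requiring two vertices for small [Z] guarantees that each vertex of
    [beta Z] has a neighbour there. *)
Record haven (G : sgraph) (K : nat) (beta : {set G} -> {set G}) : Prop := Haven {
  haven_notin : forall Z x, x \in beta Z -> x \notin Z;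
  haven_closed : forall Z x y, x \in beta Z -> y \notin Z -> adj x y -> y \in beta Z;
  haven_conn : forall Z : {set G}, #|Z| <= K ->
    {in beta Z &, forall x y, connect (adj_in (beta Z)) x y};
  haven_anti : forall Z Z' : {set G}, Z \subset Z' -> beta Z' \subset beta Z;
  haven_gt1 : forall Z : {set G}, #|Z| <= K -> 1 < #|beta Z| }.

Lemma connect_adj_in_closed (G : sgraph) (A D : {set G}) (x y : G) :
  (forall u v, u \in D -> v \in A -> adj u v -> v \in D) ->
  x \in D -> connect (adj_in A) x y -> connect (adj_in D) x y.
Proof.
move=> closedD + /connectP[p + ->]; elim: p x => //= z p IHp x xD.
case/andP=> /and3P[xz _ zA] zp; have zD := closedD _ _ xD zA xz.
apply: (@connect_trans _ _ z); last exact: IHp.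
by apply: connect1; rewrite /adj_in /= xz xD.
Qed.

Lemma component_sub (G : sgraph) (A : {set G}) x : x \in A -> component A x \subset A.
Proof. by move=> xA; apply/subsetP => y; rewrite inE; apply: connect_adj_in_mem. Qed.

Lemma component_closed (G : sgraph) (A : {set G}) x u v : x \in A ->
  u \in component A x -> v \in A -> adj u v -> v \in component A x.
Proof.
move=> xA uC vA uv; have uA := subsetP (component_sub xA) u uC.
move: uC; rewrite !inE => /connect_trans; apply.
by apply: connect1; rewrite /adj_in /= uv uA.
Qed.

Lemma component_conn (G : sgraph) (A : {set G}) x : x \in A ->
  {in component A x &, forall u v, connect (adj_in (component A x)) u v}.
Proof.
move=> xA u v uC vC; apply: (connect_adj_in_closed (A := A)) => //.
  by move=> w z; apply: component_closed.
move: uC vC; rewrite !inE => xu xv.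
by apply: connect_trans xv; rewrite connect_adj_in_sym.
Qed.

(** [beta Z] collects the vertices whose component holds a majority of [W]; two majorities share a
    vertex, so there is only one such component. A majority exceeds [K > 0], which gives two
    vertices. *)
Lemma treewidth_haven (G : sgraph) (K : nat) : 0 < K -> 3 * K < treewidth G ->
  exists beta : {set G} -> {set G}, haven K beta.
Proof.
move=> K_gt0 /treewidth_unseparated[W cardW bigW].
pose C (Z : {set G}) x := component (~: Z) x.
pose beta (Z : {set G}) := [set x in ~: Z | K < #|W :&: C Z x|].
have CE Z x y : y \in C Z x -> C Z y = C Z x.
  rewrite inE => xy; apply/setP => z; rewrite !inE; apply/idP/idP.
    exact: connect_trans.
  by apply: connect_trans; rewrite connect_adj_in_sym.
have closed Z u v : u \in beta Z -> v \in ~: Z -> adj u v -> v \in beta Z.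
  rewrite [in X in X -> _]inE => /andP[uZ ltK] vZ uv.
  rewrite inE vZ (@CE _ u) // inE; apply: connect1.
  by rewrite /adj_in /= uv uZ.
exists beta; split.
- by move=> Z x; rewrite !inE => /andP[].
- by move=> Z x y xb yZ; apply: closed xb _; rewrite in_setC.
- move=> Z _ x y xb yb; apply: (connect_adj_in_closed _ xb (A := ~: Z)).
    exact: closed.
  move: xb yb; rewrite inE => /andP[_ ltx]; rewrite inE => /andP[_ lty].
  have [z /setIP[/setIP[_ zx] /setIP[_ zy]]] :
      exists z, z \in (W :&: C Z x) :&: (W :&: C Z y).
    apply/set0Pn; apply: contraTneq isT => I0.
    have := cardsUI (W :&: C Z x) (W :&: C Z y); rewrite I0 cards0 addn0.
    have : #|(W :&: C Z x) :|: (W :&: C Z y)| <= #|W|.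
      by apply: subset_leq_card; rewrite subUset !subsetIl.
    rewrite cardW => leU eqU; rewrite eqU in leU.
    by move: (leq_trans (leq_add ltx lty) leU); clear; lia.
  move: zx zy; rewrite !inE => xz yz.
  by apply: connect_trans xz _; rewrite connect_adj_in_sym.
- move=> Z Z' ZZ'; apply/subsetP => x; rewrite !inE => /andP[xZ' ltK].
  have -> : x \notin Z by apply: contra xZ'; apply: subsetP.
  apply: leq_trans ltK _; apply/subset_leq_card/setIS/subsetP => y; rewrite !inE.
  by apply: connect_adj_inS; rewrite setCS.
- move=> Z leZ; have [x xZ ltK] := bigW Z leZ.
  have xb : x \in beta Z by rewrite !inE xZ.
  apply: (@leq_trans #|W :&: C Z x|); first exact: leq_ltn_trans K_gt0 ltK.
  apply/subset_leq_card/subsetP => y /setIP[_].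
  rewrite inE => xy; apply: (connect_adj_in_mem _ xb xy).
  by move=> u v; apply: closed.
Qed.

Definition rich (G : sgraph) (beta : {set G} -> {set G}) (k : nat) : {set G} :=
  [set v | [forall Z : {set G}, (#|Z| <= k) ==> (v \notin Z) ==> (v \in beta Z)]].

Lemma card_bigcup_leq (I : Type) (T : finType) (l : seq I) (P : pred I)
    (F : I -> {set T}) :
  #|\bigcup_(i <- l | P i) F i| <= \sum_(i <- l | P i) #|F i|.
Proof.
elim/big_rec2: _ => [|i n A _ IH]; first by rewrite cards0.
by apply: leq_trans (leq_card_setU _ _) _; rewrite leq_add2l.
Qed.

(** * From few rich vertices to a long hole *)

Section FewRich.
Variables (G : sgraph) (K k : nat) (beta : {set G} -> {set G}) (R : {set G}).
Variable (sep : G -> {set G}).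
Hypothesis hb : haven K beta.
Hypothesis sep_size : forall v, v \notin R -> #|sep v| <= k.
Hypothesis sep_notin : forall v, v \notin R -> v \notin sep v.
Hypothesis sep_beta : forall v, v \notin R -> v \notin beta (sep v).

Implicit Types (p : nat -> G) (n : nat) (D : {set G}).

Definition closed_nbhd p n : {set G} :=
  [set v | [exists i : 'I_n.+1, (p i == v) || adj (p i) v]].
Definition far p n : {set G} := ~: (R :|: closed_nbhd p n).
Definition path_sep p n : {set G} := R :|: \bigcup_(i < n.+1) sep (p i).

(** The first three conditions make [D] a component of [far p n]; the last ties it to the haven. *)
Definition territory p n D : Prop :=
  [/\ D \subset far p n,
      forall x y, x \in D -> y \in far p n -> adj x y -> y \in D,
      {in D &, forall x y, connect (adj_in D) x y} &
      exists2 x, x \in D & x \in beta (path_sep p n)].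

(** The path is kept in [beta R], so that a [D] whose outside neighbours all lie in [R] would
    swallow it. *)
Definition probe p n D : Prop :=
  [/\ induced_path p n, forall i, i <= n -> p i \in beta R & territory p n D].

Lemma closed_nbhdP p n v :
  reflect (exists2 i, i <= n & (p i == v) || adj (p i) v) (v \in closed_nbhd p n).
Proof.
rewrite inE; apply: (iffP existsP) => [[i iv]|[i lei iv]].
  by exists i; rewrite // -ltnS ltn_ord.
by exists (inord i); rewrite inordK.
Qed.

Lemma farP p n v : reflect
  (v \notin R /\ forall i, i <= n -> p i != v /\ ~~ adj (p i) v) (v \in far p n).
Proof.
rewrite in_setC in_setU negb_or; apply: (iffP andP) => [[vR vN]|[vR vN]]; split=> //.
  move=> i lei; apply/andP; rewrite -negb_or; apply: contra vN => iv.
  by apply/closed_nbhdP; exists i.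
by apply/closed_nbhdP => -[i /vN[/negPf-> /negPf->]].
Qed.

Lemma sub_far p n p' n' :
  (forall i, i <= n' -> exists2 j, j <= n & p' i = p j) -> far p n \subset far p' n'.
Proof.
move=> sub; apply/subsetP => v /farP[vR vN]; apply/farP; split=> // i lei.
by have [j lej ->] := sub i lei; apply: vN.
Qed.

Lemma sub_path_sep p n p' n' :
  (forall i, i <= n' -> exists2 j, j <= n & p' i = p j) ->
  path_sep p' n' \subset path_sep p n.
Proof.
move=> sub; apply: setUS; apply/bigcupsP => i _.
have [|j lej ->] := sub i; first by rewrite -ltnS ltn_ord.
have -> : p j = p (inord j : 'I_n.+1) by rewrite inordK.
exact: bigcup_sup.
Qed.

Lemma card_path_sep p n : (forall i, i <= n -> p i \notin R) ->
  #|path_sep p n| <= #|R| + n.+1 * k.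
Proof.
move=> pR; apply: leq_trans (leq_card_setU _ _) _; rewrite leq_add2l.
apply: leq_trans (card_bigcup_leq _ _ _) _.
have -> : n.+1 * k = \sum_(i < n.+1) k by rewrite sum_nat_const card_ord.
apply: leq_sum => i _.
by apply/sep_size/pR; rewrite -ltnS.
Qed.

(** A vertex of [beta (path_sep p n)] lies in [beta (sep (p i))]. If it were [p i] or a neighbour of
    it, then [p i] would lie there too, against the choice of [sep]. *)
Lemma beta_far p n : (forall i, i <= n -> p i \notin R) -> beta (path_sep p n) \subset far p n.
Proof.
move=> pR; apply/subsetP => x xb; apply/farP; split.
  by apply: contra (haven_notin hb xb); apply/subsetP/subsetUl.
move=> i lei; have pi := pR i lei.
have xbi : x \in beta (sep (p i)).
  apply: (subsetP (haven_anti hb _)) xb; rewrite subsetU //; apply/orP; right.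
  have -> : p i = p (inord i : 'I_n.+1) by rewrite inordK.
  exact: (bigcup_sup (inord i)).
split; apply: contra (sep_beta pi); first by move=> /eqP eqx; move: xbi; rewrite -eqx.
by move=> ix; apply: (haven_closed hb xbi); rewrite ?sep_notin // adj_sym.
Qed.

Lemma beta_notin_R p n : (forall i, i <= n -> p i \in beta R) -> forall i, i <= n -> p i \notin R.
Proof. by move=> pb i /pb /(haven_notin hb). Qed.

Lemma probe_rev p n D : probe p n D -> probe (fun i => p (n - i)) n D.
Proof.
case=> [[p_inj p_adj] pb [Dfar Dcl Dcon Dmeet]].
have eqv q q' : (forall i, i <= n -> q i = q' (n - i)) ->
    far q n \subset far q' n /\ path_sep q' n \subset path_sep q n.
  move=> qq'; have sub i : i <= n -> exists2 j, j <= n & q' i = q j.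
    by move=> lei; exists (n - i); rewrite ?leq_subr // qq' ?leq_subr // subKn.
  by split; [apply: sub_far | apply: sub_path_sep].
have [|sub1 sub2] := eqv p (fun i => p (n - i)).
  by move=> i lei; rewrite subKn.
have [//|sub3 _] := eqv (fun i => p (n - i)) p.
split.
- split=> i j lei lej; last by rewrite p_adj ?leq_subr //; lia.
  by move/p_inj; rewrite !leq_subr => /(_ isT isT); lia.
- by move=> i _; apply: pb; apply: leq_subr.
split=> //.
- exact: subset_trans Dfar sub1.
- by move=> x y xD yF; apply: Dcl xD _; apply: (subsetP sub3).
- by case: Dmeet => x xD xb; exists x => //; apply: (subsetP (haven_anti hb sub2)) xb.
Qed.

Lemma probe_boundary p n D d b : probe p n D -> d \in D -> adj d b ->
  b \notin R -> b \notin D ->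
  (exists2 i, i <= n & adj (p i) b) /\ forall i, i <= n -> p i != b.
Proof.
case=> _ _ [Dfar Dcl _ _] dD db bR bD.
have pb i : i <= n -> p i != b.
  move=> lei; have /farP[_ /(_ i lei)[_]] := subsetP Dfar d dD.
  by apply: contra => /eqP->; rewrite adj_sym.
split=> //; have : b \notin far p n by apply: contra bD => bF; apply: Dcl db.
rewrite in_setC negbK in_setU (negPf bR) => /closed_nbhdP[i lei].
by rewrite (negPf (pb i lei)) => ib; exists i.
Qed.

Definition private_nbr p n D i b : Prop :=
  [/\ b \notin R, b \notin D, exists2 d, d \in D & adj d b, adj (p i) b &
      forall j, j <= n -> j != i -> ~~ adj (p j) b].

(** Without a private neighbour of [p n], every boundary vertex of [D] outside [R] is seen by an
    earlier path vertex, so [D] stays a component after dropping [p n]. For [n = 0] no such boundary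
    vertex exists, and connectedness of [beta R] would put [p 0] into [D]. *)
Lemma probe_last p n D : #|R| <= K -> probe p n D ->
  (exists b, private_nbr p n D n b) \/ (0 < n /\ probe p n.-1 D).
Proof.
move=> leRK prD; apply: contrapT => /not_orP[nob no_drop].
have bdry d b : d \in D -> adj d b -> b \notin R -> b \notin D ->
    exists2 i, i < n & adj (p i) b.
  move=> dD db bR bD; have [[i lei ib] _] := probe_boundary prD dD db bR bD.
  move: lei; rewrite leq_eqVlt => /predU1P[eqi|lti]; last by exists i.
  apply: contrapT => noi; apply: nob; exists b; split=> //; first by exists d.
    by rewrite -eqi.
  by move=> j lej neqj; apply/negP => jb; apply: noi; exists j => //; lia.
case: prD => [[p_inj p_adj] pb [Dfar Dcl Dcon [x xD xb]]].
case: (posnP n) => [n0|n_gt0].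
  have closedR u v : u \in D -> v \in ~: R -> adj u v -> v \in D.
    rewrite in_setC => uD vR uv; apply: contrapT => /negP vD.
    by have [i] := bdry u v uD uv vR vD; rewrite n0.
  have bR : beta R \subset ~: R by apply/subsetP => v; rewrite in_setC; apply: (haven_notin hb).
  have p0b : p 0 \in beta R by apply: pb.
  have xbR : x \in beta R by apply: (subsetP (haven_anti hb (subsetUl _ _))) xb.
  have p0D := connect_adj_in_mem closedR xD (connect_adj_inS bR (haven_conn hb leRK xbR p0b)).
  by have /farP[_ /(_ 0 isT)[]] := subsetP Dfar _ p0D; rewrite eqxx.
apply: no_drop; split=> //.
have sub i : i <= n.-1 -> exists2 j, j <= n & p i = p j.
  by move=> lei; exists i => //; lia.
split.
- by split=> i j lei lej; [apply: p_inj | apply: p_adj]; lia.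
- by move=> i lei; apply: pb; lia.
split=> //.
- exact: subset_trans Dfar (sub_far sub).
- move=> u v uD /farP[vR vfar] uv; apply: contrapT => /negP vD.
  have [i lti iv] := bdry u v uD uv vR vD.
  by have [|_ /negP] := vfar i; first by lia.
by exists x => //; apply: (subsetP (haven_anti hb (sub_path_sep sub))) xb.
Qed.

(** The new territory is the component that meets [beta] of the larger separator. It lies in [D] but
    loses the neighbour [d] of the appended vertex. *)
Lemma probe_extend p n D b : #|R| + n.+2 * k <= K -> probe p n D ->
  private_nbr p n D n b -> exists p' D', probe p' n.+1 D' /\ #|D'| < #|D|.
Proof.
move=> leK prD [bR bD [d dD db] nb nob].
have [_ pNb] := probe_boundary prD dD db bR bD.
case: prD => [[p_inj p_adj] pb [Dfar Dcl Dcon [x xD xb]]].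
pose p' i := if i <= n then p i else b.
have p'p i : i <= n -> p' i = p i by rewrite /p' => ->.
have p'n : p' n.+1 = b by rewrite /p' ltnn.
have p'b i : i <= n.+1 -> p' i \in beta R.
  rewrite leq_eqVlt => /predU1P[->|lti]; last by rewrite p'p // pb.
  by rewrite p'n; apply: (haven_closed hb (pb n _)).
have p'R := beta_notin_R p'b; have pR := beta_notin_R pb.
have sub i : i <= n -> exists2 j, j <= n.+1 & p i = p' j.
  by move=> lei; exists i; [lia | rewrite p'p].
have lep' : #|path_sep p' n.+1| <= K by apply: leq_trans (card_path_sep p'R) leK.
have sepS := sub_path_sep sub; have farS := sub_far sub.
have lep : #|path_sep p n| <= K by apply: leq_trans (subset_leq_card sepS) lep'.
have /card_gt0P[y yb'] : 0 < #|beta (path_sep p' n.+1)| by apply: ltnW; apply: (haven_gt1 hb).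
have yF' := subsetP (beta_far p'R) y yb'.
have yb := subsetP (haven_anti hb sepS) y yb'.
have yD : y \in D.
  apply: (connect_adj_in_mem _ xD (haven_conn hb lep xb yb)) => u v uD vb.
  by apply: Dcl uD _; apply: (subsetP (beta_far pR)).
pose D' := component (far p' n.+1) y.
exists p', D'; split.
  split=> //.
    apply: induced_path_rcons => // i lti.
    by apply: nob; [apply: ltnW | rewrite ltn_eqF].
  split.
  - exact: component_sub.
  - by move=> u v; apply: component_closed.
  - exact: component_conn.
  by exists y => //; rewrite inE connect0.
apply: proper_card; apply/properP; split.
  apply/subsetP => z; rewrite inE => yz; apply: connect_adj_in_mem yD yz => u v uD vF'.
  by apply: Dcl uD _; apply: (subsetP farS).
exists d => //; apply/negP => /(subsetP (component_sub yF')) /farP[_ /(_ n.+1 (leqnn _))[_]].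
by rewrite p'n adj_sym db.
Qed.

Lemma probe_hole p n D a b : 1 < n -> probe p n D ->
  private_nbr p n D 0 a -> private_nbr p n D n b -> has_hole n.+2 G.
Proof.
move=> n_gt1 prD [aR aD [da daD daa] a0 noa] [bR bD [db dbD dbb] bn nob].
have [_ pNa] := probe_boundary prD daD daa aR aD.
have [_ pNb] := probe_boundary prD dbD dbb bR bD.
case: prD => [p_ind pb [Dfar Dcl Dcon _]].
pose Y := a |: (b |: D).
have aY : a \in Y by rewrite setU11.
have bY : b \in Y by rewrite !inE eqxx orbT.
have DY : D \subset Y by rewrite /Y setUA subsetUr.
have toD y : y \in Y -> exists2 d, d \in D & connect (adj_in Y) y d.
  rewrite !inE => /or3P[/eqP->|/eqP->|yD]; [exists da | exists db | exists y] => //.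
  - by apply: connect1; rewrite /adj_in /= adj_sym daa aY (subsetP DY).
  - by apply: connect1; rewrite /adj_in /= adj_sym dbb bY (subsetP DY).
apply: (@hole_close _ p n Y a b) => //.
- move=> x y /toD[dx dxD xdx] /toD[dy dyD ydy].
  apply: connect_trans xdx _; rewrite connect_adj_in_sym.
  apply: connect_trans ydy _; apply: connect_adj_inS DY _; exact: Dcon.
- move=> i lei; rewrite !inE (negPf (pNa i lei)) (negPf (pNb i lei)) /=.
  by apply/negP => /(subsetP Dfar)/farP[_ /(_ i lei)[]]; rewrite eqxx.
move=> i y /andP[i_gt0 ltin]; have lein := ltnW ltin.
rewrite !inE => /or3P[/eqP->|/eqP->|yD].
- by apply: noa; rewrite -?lt0n.
- by apply: nob; rewrite ?ltn_eqF.
by have /farP[_ /(_ i lein)[]] := subsetP Dfar _ yD.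
Qed.

Lemma probe_last_hole s : 2 < s -> #|R| + s * k <= K -> has_hole s.+1 G.
Proof.
move=> s_gt2 leK; have leRK : #|R| <= K by apply: leq_trans leK; apply: leq_addr.
apply: contrapT => nohole.
have leKn n : n < s -> #|R| + n.+1 * k <= K.
  by move=> ltns; apply: leq_trans leK; rewrite leq_add2l leq_mul2r ltns orbT.
have noprobe p n D : n < s -> ~ probe p n D.
  (* As [n < s], this measure is lexicographic in [#|D|] and [n]: dropping an end lowers [n],
     extending lowers [#|D|]. *)
  have [M] := ubnP (#|D| * s + n); elim: M => // M IHM in p n D *.
  move=> ltM ltns prD.
  have [[b pb]|[n_gt0]] := probe_last leRK prD; last first.
    by apply: IHM; lia.
  have prD' := probe_rev prD.
  have [[a pa]|[n_gt0]] := probe_last leRK prD'; last first.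
    by apply: IHM; lia.
  have [ltn1s|] := ltnP n.+1 s.
    have [p' [D' [prD1 ltD]]] := probe_extend (leKn _ ltn1s) prD pb.
    by apply: IHM prD1 => //; nia.
  (* The path has [s] vertices and private neighbours at both ends, so it closes up. *)
  move=> lesn; have eqs : s = n.+1 by lia.
  apply: nohole; rewrite eqs; apply: (probe_hole (a := a) _ prD _ pb); first by lia.
  case: pa => aR aD ad /=; rewrite subnn => a0 noa; split=> // j lej neqj.
  by have := noa (n - j); rewrite subKn //; apply; lia.
have /card_gt0P[v vb] : 0 < #|beta R| by apply: ltnW; apply: (haven_gt1 hb).
pose p := fun _ : nat => v.
have pR i : i <= 0 -> p i \notin R by move=> _; apply: (haven_notin hb vb).
have leK0 : #|path_sep p 0| <= K.
  by apply: leq_trans (card_path_sep pR) (leKn _ _); apply: leq_trans s_gt2.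
have /card_gt0P[x xb] : 0 < #|beta (path_sep p 0)| by apply: ltnW; apply: (haven_gt1 hb).
have xF := subsetP (beta_far pR) x xb.
apply: (noprobe p 0 (component (far p 0) x)); first by lia.
split=> //.
  by split=> [[|i] [|j]|[|i] [|j]] //; rewrite adj_irr.
split.
- exact: component_sub.
- by move=> u w; apply: component_closed.
- exact: component_conn.
by exists x => //; rewrite inE connect0.
Qed.

End FewRich.

(** For a vertex that is not rich, a set witnessing this serves as [sep v]. *)
Lemma many_rich (G : sgraph) (K k m s : nat) (beta : {set G} -> {set G}) :
  haven K beta -> 2 < s -> m + s * k <= K -> ~ has_hole s.+1 G ->
  m <= #|rich beta k|.
Proof.
move=> hb s_gt2 leK nohole; rewrite leqNgt; apply/negP => ltm; apply: nohole.
set R := rich beta k in ltm.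
have /choice[sep sepP] (v : G) : exists Z : {set G},
    v \notin R -> [/\ #|Z| <= k, v \notin Z & v \notin beta Z].
  have [vR|] := boolP (v \in R); first by exists set0.
  rewrite inE => /forallPn[Z]; rewrite !negb_imply => /and3P[leZ vZ vb].
  by exists Z.
apply: (@probe_last_hole G K k beta R sep hb) => //.
- by move=> v /sepP[].
- by move=> v /sepP[].
- by move=> v /sepP[].
apply: leq_trans leK; rewrite leq_add2r; exact: ltnW.
Qed.

(** * Long H-graphs *)

Definition has_H (s : nat) (G : sgraph) : Prop :=
  exists join0 joini i,
    [/\ 1 <= i, s <= i.+1 & induced_subgraph (H_gen join0 joini i) G].

(** Reading the two flags off the pendant pairs treats all kinds of H-graphs at once. *)
Lemma H_gen_induced (G : sgraph) (b : nat -> G) (i : nat) (c d : bool -> G) :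
  induced_path b i -> injective c -> injective d ->
  (forall e j, j <= i -> c e != b j) -> (forall e j, j <= i -> d e != b j) ->
  (forall e e', c e != d e') -> (forall e e', ~~ adj (c e) (d e')) ->
  (forall e j, j <= i -> adj (c e) (b j) = (j == 0)) ->
  (forall e j, j <= i -> adj (d e) (b j) = (j == i)) ->
  induced_subgraph (H_gen (adj (c false) (c true)) (adj (d false) (d true)) i) G.
Proof.
move=> [b_inj b_adj] c_inj d_inj cNb dNb cNd cd_anti cb db.
pose f (x : 'I_i.+1 + bool * bool) : G :=
  match x with
  | inl j => b j
  | inr (e, h) => if e then d h else c h
  end.
have joinE (g : bool -> G) h h' :
    adj (g h) (g h') = (h != h') && adj (g false) (g true).
  by case: h h' => -[]; rewrite ?adj_irr // adj_sym.
exists f.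
  case=> [j|[e h]] [k|[e' h']] /=.
  - by move/b_inj => eqjk; congr inl; apply: val_inj; apply: eqjk; rewrite -ltnS.
  - by case: e' => /esym/eqP eqf;
       [case/idPn: eqf; apply: dNb | case/idPn: eqf; apply: cNb]; rewrite -ltnS.
  - by case: e => /eqP eqf;
       [case/idPn: eqf; apply: dNb | case/idPn: eqf; apply: cNb]; rewrite -ltnS.
  - case: e e' => -[] // => [/d_inj-> | /esym/eqP | /eqP | /c_inj->] //.
      by rewrite (negPf (cNd _ _)).
    by rewrite (negPf (cNd _ _)).
case=> [j|[e h]] [k|[e' h']].
- by rewrite /= b_adj // -ltnS.
- change (adj (b j) (if e' then d h' else c h') = (j == (if e' then ord_max else ord0))).
  have lej : j <= i by rewrite -ltnS.
  by rewrite adj_sym; case: e'; rewrite ?db ?cb.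
- change (adj (if e then d h else c h) (b k) = (k == (if e then ord_max else ord0))).
  have lek : k <= i by rewrite -ltnS.
  by case: e; rewrite ?db ?cb.
change (adj (if e then d h else c h) (if e' then d h' else c h') =
  [&& e == e', h != h' & if e then adj (d false) (d true) else adj (c false) (c true)]).
case: e e' => -[] /=.
- exact: joinE.
- by rewrite adj_sym; apply: negPf.
- exact: negPf.
- exact: joinE.
Qed.

Definition geodesic_path (G : sgraph) (A : {set G}) (p : nat -> G) (n : nat) : Prop :=
  [/\ forall i, i <= n -> p i \in A, induced_path p n &
    forall m w, walk A w m -> w 0 = p 0 -> w m = p n -> n <= m].

Lemma geodesic_path_rev (G : sgraph) (A : {set G}) p n :
  geodesic_path A p n -> geodesic_path A (fun i => p (n - i)) n.
Proof.
case=> pA [p_inj p_adj] short; split.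
- by move=> i _; apply: pA; apply: leq_subr.
- split=> i j lei lej; last by rewrite p_adj ?leq_subr //; lia.
  by move/p_inj; rewrite !leq_subr => /(_ isT isT); lia.
move=> m w [wA wadj]; rewrite subn0 subnn => w0 wm.
apply: (short m (fun i => w (m - i))); rewrite ?subn0 ?subnn //.
split=> i lei; first by apply: wA; apply: leq_subr.
by rewrite adj_sym -[m - i]subnSK // wadj //; lia.
Qed.

(* Off the path, a neighbour of [p 0] can be adjacent to [p 0], [p 1] and [p 2]
   only, so two of four such neighbours last touch the path at the same place. *)
Lemma geodesic_fork (G : sgraph) (A : {set G}) p n :
  1 < n -> geodesic_path A p n -> 4 < #|[set c in A | adj (p 0) c]| ->
  exists o (c : bool -> G), [/\ o <= 2, injective c,
    forall e, (c e \in A) && adj (p 0) (c e),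
    forall e j, j <= n -> c e != p j &
    forall e j, o <= j -> j <= n -> adj (c e) (p j) = (j == o)].
Proof.
move=> n_gt1 [pA [p_inj p_adj] short]; set N := [set c in A | _] => ltN.
pose T := N :\ p 1.
(* Apart from [p 1], four neighbours remain for the three possible values of [o]. *)
have ltT : 3 < #|T| by move: ltN; rewrite (cardsD1 (p 1) N) /T; case: (_ \in N); lia.
have TP c : c \in T -> [/\ c \in A, adj (p 0) c & forall j, j <= n -> c != p j].
  rewrite !inE => /and3P[cp1 cA p0c]; split=> // j lej.
  apply: contraNneq cp1 => eqj; move: p0c; rewrite eqj p_adj //= orbF.
  by move/eqP=> <-.
have far c j : c \in T -> 2 < j -> j <= n -> ~~ adj (c) (p j).
  case/TP=> cA p0c _ j_gt2 lejn; apply/negP => cj.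
  pose w k := if k is k'.+1 then (if k' is k''.+1 then p (j + k'') else c) else p 0.
  have wm : w (n - j).+2 = p n by rewrite /w subnKC.
  have ww : walk A w (n - j).+2.
    split=> [[|[|k]] lek /=|[|[|k]] ltk /=] //; try by apply: pA; lia.
      by rewrite addn0.
    by rewrite p_adj; lia.
  by have := short _ w ww erefl wm; lia.
pose Q o c := (c \in T) && ((adj c (p o)) && [forall j : 'I_3, (o < j) ==> ~~ adj c (p j)]).
pose T_ o : {set G} := [set c | Q o c].
have : T \subset T_ 0 :|: T_ 1 :|: T_ 2.
  apply/subsetP => c cT; rewrite !inE /Q cT /=.
  have [_ p0c _] := TP c cT; rewrite [adj c (p 0)]adj_sym p0c /=.
  have [c2|c2] := boolP (adj c (p 2)).
    by apply/orP; right; apply/forallP => -[[|[|[|]]]].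
  have [c1|c1] := boolP (adj c (p 1)).
    by apply/orP; left; apply/orP; right; apply/forallP => -[[|[|[|]]]].
  by apply/orP; left; apply/orP; left; apply/forallP => -[[|[|[|]]]].
move/subset_leq_card => leT.
have [o leo lto] : exists2 o, o <= 2 & 1 < #|T_ o|.
  have le01 : #|T_ 0 :|: T_ 1| <= #|T_ 0| + #|T_ 1| := leq_card_setU _ _.
  have le012 : #|T_ 0 :|: T_ 1 :|: T_ 2| <= #|T_ 0 :|: T_ 1| + #|T_ 2| := leq_card_setU _ _.
  have: 3 < #|T_ 0| + #|T_ 1| + #|T_ 2|.
    apply: leq_trans ltT (leq_trans leT (leq_trans le012 _)).
    by rewrite leq_add2r.
  case: (ltnP 1 #|T_ 0|) => [|le0]; first by exists 0.
  case: (ltnP 1 #|T_ 1|) => [|le1]; first by exists 1.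
  case: (ltnP 1 #|T_ 2|) => [|le2]; first by exists 2.
  by rewrite ltnNge (leq_trans (leq_add (leq_add le0 le1) le2)).
have /card_gt1P[x [y [xT yT neqxy]]] := lto.
exists o, (fun e => if e then x else y).
have QP c : c \in T_ o -> [/\ c \in T, adj c (p o) & forall j, o < j -> j <= n -> ~~ adj c (p j)].
  rewrite inE => /and3P[cT co /forallP cNj]; split=> // j ltoj lejn.
  have [j_gt2|] := ltnP 2 j; first exact: far.
  by move=> lej2; have := cNj (inord j); rewrite inordK // ltoj.
have inT e : (if e then x else y) \in T_ o by case: e.
split=> //.
- by move=> [] [] // => [eqxy|/esym eqxy]; case/eqP: neqxy.
- by move=> e; have [/TP[-> ->]] := QP _ (inT e).
- by move=> e; have [/TP[]] := QP _ (inT e).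
move=> e j; rewrite leq_eqVlt => /predU1P[<- _|ltoj lejn].
  by have [_ -> _] := QP _ (inT e); rewrite eqxx.
have [_ _ /(_ j ltoj lejn)/negPf->] := QP _ (inT e).
by rewrite gtn_eqF.
Qed.

(** The body is the part of [p] between the fork points, which drops at most two vertices at each
    end. A common vertex of the two forks, or an edge between them, would give a walk of length at
    most three between the ends of [p]. *)
Lemma geodesic_H (G : sgraph) (A : {set G}) p n s :
  s + 5 <= n -> geodesic_path A p n ->
  4 < #|[set c in A | adj (p 0) c]| -> 4 < #|[set c in A | adj (p n) c]| ->
  has_H s G.
Proof.
move=> len geo deg0 degn; have [pA [p_inj p_adj] short] := geo.
have [|o [c [leo c_inj cA cNp cp]]] := geodesic_fork _ geo deg0; first by lia.
have [||o' [d [leo' d_inj dA dNp dp]]] := geodesic_fork _ (geodesic_path_rev geo) _.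
- by lia.
- by rewrite subn0.
rewrite subn0 in dA.
have cAe e : c e \in A by have /andP[] := cA e.
have dAe e : d e \in A by have /andP[] := dA e.
have pce e : adj (p 0) (c e) by have /andP[] := cA e.
have pde e : adj (d e) (p n) by have /andP[_] := dA e; rewrite adj_sym.
exists (adj (c false) (c true)), (adj (d false) (d true)), (n - o - o').
split; [lia | lia |].
apply: (@H_gen_induced _ (fun j => p (o + j))) => //.
- split=> j k lej lek; last by rewrite p_adj; lia.
  by move/p_inj; lia.
- by move=> e j lej; apply: cNp; lia.
- by move=> e j lej; have := dNp e (n - (o + j)); rewrite subKn; [apply; lia | lia].
- move=> e e'; apply/eqP => eqcd.
  pose w k := if k is k'.+1 then (if k' is 0 then c e else p n) else p 0.
  have ww : walk A w 2.
    by split=> [[|[|k]] lek|[|[|k]] ltk] //=; rewrite ?eqcd //; apply: pA.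
  by have := short 2 w ww erefl erefl; lia.
- move=> e e'; apply/negP => cd.
  pose w k := match k with 0 => p 0 | 1 => c e | 2 => d e' | _ => p n end.
  have ww : walk A w 3.
    by split=> [[|[|[|k]]] lek|[|[|[|k]]] ltk] //=; apply: pA.
  by have := short 3 w ww erefl erefl; lia.
- by move=> e j lej; rewrite cp; lia.
- by move=> e j lej; have := dp e (n - (o + j)); rewrite subKn; lia.
Qed.

(** By [geodesic_H] a shortest path has at most [s + 4] edges; [P] lists its inner vertices. *)
Lemma short_path (G : sgraph) (A : {set G}) (x y : G) (s : nat) :
  ~ has_H s G -> x \in A -> x != y -> connect (adj_in A) x y ->
  4 < #|[set c in A | adj x c]| -> 4 < #|[set c in A | adj y c]| ->
  exists P : seq G, [/\ size P <= s + 3, {subset P <= A :\ x :\ y} &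
    path (@adj G) x (rcons P y)].
Proof.
move=> noH xA neqxy conn degx degy.
have [n [p [p0 pn pA p_ind short]]] := geodesic xA conn.
have ltn : n < s + 5.
  rewrite ltnNge; apply/negP => len; apply: noH.
  have geo : geodesic_path A p n by split=> //; rewrite p0 pn.
  by apply: (geodesic_H len geo); rewrite ?p0 ?pn.
have n_gt0 : 0 < n by case: n pn {pA p_ind short ltn} => // pn; rewrite -p0 -pn eqxx in neqxy.
have [p_inj p_adj] := p_ind.
exists (mkseq (fun i => p i.+1) n.-1); split.
- by rewrite size_mkseq; lia.
- move=> z /mapP[i]; rewrite mem_iota => lti ->; rewrite !inE pA; last by lia.
  rewrite -p0 -pn !andbT; apply/andP.
  by split; apply/eqP => /p_inj; lia.
apply/(pathP x) => i; rewrite size_rcons size_mkseq => lti.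
have nthE j : j <= n -> nth x (x :: rcons (mkseq (fun i => p i.+1) n.-1) y) j = p j.
  case: j => [|j] //= lej; rewrite nth_rcons size_mkseq.
  case: ltnP => [ltj|]; first by rewrite nth_mkseq.
  by move=> lenj; rewrite (_ : j = n.-1) ?eqxx ?prednK //; lia.
rewrite nthE; last by lia.
have := nthE i.+1; rewrite /= => ->; last by lia.
by rewrite p_adj ?eqxx //; lia.
Qed.

Lemma has_H_canonical (G : sgraph) (s : nat) : has_H s G ->
  exists (C : sgraph) (k : nat), [/\ canonical C k, s <= k & induced_subgraph C G].
Proof.
case=> j0 [ji [i [i_gt0 les ind]]].
case: j0 ji ind => -[] ind; [| |
  exists (H'_graph i), i.+1; split=> //; first exact: canonical_H' |].
- by exists (H''_graph i), i.+1; split=> //; apply: canonical_H''.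
- by exists (H'_graph i), i.+1; split=> //; apply: canonical_H'.
(* Here only the second end is joined; reversing the body and exchanging the ends gives
   [H'_graph i]. *)
- case: ind => f f_inj f_adj.
  pose r (x : H'_graph i) : H_gen false true i :=
    match x with inl j => inl (rev_ord j) | inr (e, h) => inr (~~ e, h) end.
  exists (f \o r).
    apply: inj_comp f_inj _.
    move=> [j|[e h]] [k|[e' h']] //= [].
      by move=> eqjk; congr inl; apply: rev_ord_inj; apply: val_inj.
    by move=> /negb_inj-> ->.
  have rev_end (j : 'I_i.+1) e : (rev_ord j == (if ~~ e then ord_max else ord0)) =
      (j == (if e then ord_max else ord0)).
    rewrite -(inj_eq rev_ord_inj j); congr (_ == _); apply: val_inj.
    by case: e; rewrite /= ?subnn // subn1.
  move=> x y; rewrite /= f_adj; case: x y => [j|[e h]] [k|[e' h']].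
  - by rewrite /= /H_adj /=; have := ltn_ord j; have := ltn_ord k; lia.
  - exact: rev_end.
  - exact: rev_end.
  - by case: e e' h h' => -[] [] [].
- by exists (H_graph i), i.+1; split=> //; apply: canonical_H.
Qed.

Lemma has_hole_canonical (G : sgraph) (s : nat) : has_hole s G ->
  exists (C : sgraph) (k : nat), [/\ canonical C k, s <= k & induced_subgraph C G].
Proof. by case=> n [n_ge4 les ind]; exists (cycle_graph n), n; split=> //; constructor. Qed.

(** * Subdivided cliques *)

(** Each sequence avoids those already chosen, which together have at most [size l * r] elements. *)
Lemma greedy_disjoint (T : finType) (E : eqType) (r : nat)
    (good : E -> seq T -> Prop) (l : seq E) : uniq l ->
  (forall e (Z : {set T}), e \in l -> #|Z| <= size l * r ->
     exists P, [/\ size P <= r, good e P & forall x, x \in P -> x \notin Z]) ->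
  exists F : E -> seq T,
    (forall e, e \in l -> size (F e) <= r /\ good e (F e)) /\
    (forall e e' x, e \in l -> e' \in l -> e != e' -> x \in F e -> x \notin F e').
Proof.
elim: l => [|e l IHl] /=; first by move=> _ _; exists (fun=> [::]).
case/andP=> el ul ex; have [|F [Fgood Fdis]] := IHl ul.
  by move=> d Z dl leZ; apply: ex; rewrite ?inE ?dl ?orbT // mulSn; lia.
pose Z := \bigcup_(d <- l) [set x in F d].
have leZ : #|Z| <= (size l).+1 * r.
  apply: leq_trans (card_bigcup_leq _ _ _) _; rewrite mulSn; apply: leq_trans (leq_addl _ _).
  rewrite -sum1_size big_distrl /= big_seq [leqRHS]big_seq; apply: leq_sum => d /Fgood[led _].
  by rewrite mul1n; apply: leq_trans led; rewrite cardsE card_size.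
have inZ d x : d \in l -> x \in F d -> x \in Z.
  by move=> dl xd; rewrite /Z (big_rem d) //= !inE xd.
have [|P [leP goodP PZ]] := ex e Z _ leZ; first by rewrite inE eqxx.
have neqe d : d \in l -> (d == e) = false by apply: contraTF => /eqP->.
exists (fun d => if d == e then P else F d); split.
  by move=> d; rewrite inE => /predU1P[->|dl]; rewrite ?eqxx // neqe //; apply: Fgood.
move=> d d' x; rewrite !inE => /predU1P[->|dl] /predU1P[->|d'l]; rewrite ?eqxx //.
- by rewrite (neqe d') // => _ xP; apply: contra (PZ x xP); apply: inZ.
- by rewrite (neqe d) // => _; apply: contraL => /PZ; apply: contra; apply: inZ.
- by rewrite !neqe //; apply: Fdis.
Qed.

(** Each path is given by its inner vertices, for [i < j] only. Edges between different paths are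
    allowed; cleaning deals with them. *)
Definition subdivided_clique (G : sgraph) (m r : nat) (v : nat -> G)
    (P : nat -> nat -> seq G) : Prop :=
  [/\ forall i j, i < m -> j < m -> v i = v j -> i = j,
      forall i j, i < j -> j < m ->
        size (P i j) <= r /\ path (@adj G) (v i) (rcons (P i j) (v j)),
      forall i j k, i < j -> j < m -> k < m -> v k \notin P i j &
      forall i j k l x, i < j -> j < m -> k < l -> l < m -> (i, j) != (k, l) ->
        x \in P i j -> x \notin P k l].

(** Otherwise [Z] and the other neighbours of [v] form a set small enough for richness to put [v]
    into its [beta]. There [v] would be isolated, although that set is connected and has a second
    vertex. *)
Lemma rich_degree (G : sgraph) (K k : nat) (beta : {set G} -> {set G}) (Z : {set G}) v :
  haven K beta -> k <= K -> #|Z| + 4 <= k -> v \in rich beta k -> v \notin Z ->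
  4 < #|[set c in ~: Z | adj v c]|.
Proof.
move=> hb lekK leZ; rewrite inE => /forallP richv vZ.
rewrite ltnNge; apply/negP => leN; set N := [set c in _ | _] in leN.
have leZN : #|Z :|: N| <= k.
  apply: leq_trans (leq_card_setU _ _) _; apply: leq_trans leZ; by rewrite leq_add2l.
have vZN : v \notin Z :|: N by rewrite !inE (negPf vZ) adj_irr andbF.
have vb : v \in beta (Z :|: N) by have := richv (Z :|: N); rewrite leZN vZN.
have leK := leq_trans leZN lekK.
have /card_gt1P[x [y [xb yb neqxy]]] := haven_gt1 hb leK.
have [z zb neqz] : exists2 z, z \in beta (Z :|: N) & z != v.
  by have [eqx|] := eqVneq x v; [exists y; rewrite // -eqx eq_sym | exists x].
have /connectP[[|u s] /= us eqz] := haven_conn hb leK vb zb.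
  by rewrite eqz eqxx in neqz.
have /andP[/and3P[vu _ ub] _] := us.
have := haven_notin hb ub; rewrite in_setU negb_or => /andP[uZ].
by rewrite !inE uZ vu.
Qed.

(** Paths are chosen greedily by [short_path]. By richness both ends lie in the connected set
    [beta Z'], where [Z'] consists of the used vertices and the other branch vertices. The bound on
    [k] counts branch vertices, path vertices and the 4 of [rich_degree]. *)
Lemma rich_subdivided_clique (G : sgraph) (K k m s : nat)
    (beta : {set G} -> {set G}) (v : nat -> G) :
  haven K beta -> ~ has_H s G -> k <= K -> m + m * m * (s + 3) + 4 <= k ->
  (forall i, i < m -> v i \in rich beta k) ->
  (forall i j, i < m -> j < m -> v i = v j -> i = j) ->
  exists P, subdivided_clique m (s + 3) v P.
Proof.
move=> hb noH lekK lek v_rich v_inj.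
pose B := [set v (val i) | i : 'I_m].
have inB i : i < m -> v i \in B by move=> lti; apply/imsetP; exists (Ordinal lti).
pose l := [seq (i, j) | i <- iota 0 m, j <- iota 0 m].
have inl i j : i < m -> j < m -> (i, j) \in l.
  by move=> lti ltj; apply: allpairs_f; rewrite mem_iota.
(* For pairs that are not increasing the condition is vacuous and the empty sequence serves. *)
pose good (e : nat * nat) (P : seq G) := e.1 < e.2 ->
  path (@adj G) (v e.1) (rcons P (v e.2)) /\ forall x, x \in P -> x \notin B.
have sz_l : size l = m * m by rewrite size_allpairs size_iota.
have [|e Z /allpairsP[[i j] /= [+ + ->]] leZ|F [Fgood Fdis]] :=
    @greedy_disjoint G _ (s + 3) good l.
- by apply: allpairs_uniq; rewrite ?iota_uniq //; move=> [a b] [c d].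
- rewrite !mem_iota /= !add0n => lti ltj; have [ltij|leji] := ltnP i j; last first.
    by exists [::]; split=> //; rewrite /good /= ltnNge leji.
  pose Z' := (Z :|: B) :\ v i :\ v j.
  have leZ' : #|Z'| + 4 <= k.
    apply: leq_trans lek; rewrite leq_add2r.
    apply: (@leq_trans #|Z :|: B|).
      by apply: subset_leq_card; apply: subset_trans (subsetDl _ _) (subsetDl _ _).
    apply: leq_trans (leq_card_setU _ _) _; rewrite addnC -sz_l leq_add //.
    by apply: leq_trans (leq_imset_card _ _) _; rewrite card_ord.
  have viZ : v i \notin Z' by rewrite !inE eqxx andbF.
  have vjZ : v j \notin Z' by rewrite !inE eqxx.
  have leZk : #|Z'| <= k by apply: leq_trans leZ'; apply: leq_addr.
  have inb h : h < m -> v h \notin Z' -> v h \in beta Z'.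
    by move=> lth vhZ; have := v_rich h lth; rewrite inE => /forallP/(_ Z'); rewrite leZk vhZ.
  have conn := haven_conn hb (leq_trans leZk lekK) (inb _ lti viZ) (inb _ ltj vjZ).
  have bZ : beta Z' \subset ~: Z'.
    by apply/subsetP => x /(haven_notin hb); rewrite in_setC.
  have [|||||P [leP PA pathP]] := @short_path G (~: Z') (v i) (v j) s noH.
  + by rewrite in_setC.
  + by apply/eqP => /(v_inj _ _ lti ltj) eqij; rewrite eqij ltnn in ltij.
  + exact: connect_adj_inS bZ conn.
  + exact: rich_degree hb lekK leZ' (v_rich _ lti) viZ.
  + exact: rich_degree hb lekK leZ' (v_rich _ ltj) vjZ.
  have PZB x : x \in P -> x \notin Z :|: B.
    move=> /PA; rewrite !in_setD1 in_setC => /and3P[xj xi].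
    by rewrite /Z' !in_setD1 xi xj.
  exists P; split=> //; last by move=> x /PZB; rewrite in_setU negb_or => /andP[].
  by move=> _; split=> // x /PZB; rewrite in_setU negb_or => /andP[].
exists (fun i j => F (i, j)); split=> //.
- move=> i j ltij ltj; have [leF /(_ ltij)[pF _]] := Fgood _ (inl i j (ltn_trans ltij ltj) ltj).
  by split.
- move=> i j h ltij ltj lth; have [_ /(_ ltij)[_ FB]] := Fgood _ (inl i j (ltn_trans ltij ltj) ltj).
  by apply/negP => /FB/negP; apply; apply: inB.
- move=> i j h h' x ltij ltj lth lth' neq; apply: Fdis neq; apply: inl => //.
    exact: ltn_trans ltij ltj.
  exact: ltn_trans lth lth'.
Qed.

(** * Cleaning a subdivided clique *)

Lemma sorted_subseq_iota (s : seq nat) n :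
  sorted ltn s -> all (fun x => x < n) s -> subseq s (iota 0 n).
Proof.
move=> s_sorted /allP s_lt; suff -> : s = [seq x <- iota 0 n | x \in s] by apply: filter_subseq.
apply: (irr_sorted_eq ltn_trans ltnn) => //.
  by apply: sorted_filter (iota_ltn_sorted 0 n); apply: ltn_trans.
move=> x; rewrite mem_filter mem_iota /= add0n; apply/idP/andP => [xs|[]//].
by rewrite s_lt.
Qed.

Lemma subseq_map_nth (T : eqType) (x0 : T) (h : seq T) (s : seq nat) :
  sorted ltn s -> all (fun x => x < size h) s -> subseq (map (nth x0 h) s) h.
Proof.
move=> s_sorted s_lt; rewrite -{2}[h](mkseq_nth x0).
exact/map_subseq/sorted_subseq_iota.
Qed.

Lemma subseq_cover (T : eqType) (h s : seq T) c : uniq h -> {subset s <= h} ->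
  size s <= c <= size h ->
  exists t, [/\ subseq t h, size t = c & {subset s <= t}].
Proof.
move=> uh sh /andP[lesc lech]; pose s1 := undup s.
have us1 : uniq s1 by apply: undup_uniq.
have s1h : {subset s1 <= h} by move=> x; rewrite mem_undup; apply: sh.
have les1 : size s1 <= c by apply: leq_trans (size_undup s) lesc.
have sz1 : size [seq x <- h | x \in s1] = size s1.
  apply: perm_size; apply: uniq_perm => //; first exact: filter_uniq.
  by move=> x; rewrite mem_filter; apply: andb_idr; apply: s1h.
pose r := take (c - size s1) [seq x <- h | x \notin s1].
have sz_r : size r = c - size s1.
  apply: size_takel; rewrite -(leq_add2l (size s1)) subnKC // -sz1.
  by rewrite !size_filter count_predC.
have ur : uniq (s1 ++ r).
  rewrite cat_uniq us1 take_uniq ?filter_uniq // andbT; apply/hasPn => x /mem_take.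
  by rewrite mem_filter => /andP[].
exists [seq x <- h | x \in s1 ++ r]; split; first exact: filter_subseq.
  rewrite -[RHS](subnKC les1) -sz_r -size_cat; apply: perm_size; apply: uniq_perm => //.
    exact: filter_uniq.
  move=> x; rewrite mem_filter; apply: andb_idr; rewrite mem_cat => /orP[/s1h//|/mem_take].
  by rewrite mem_filter => /andP[].
by move=> x xs; rewrite mem_filter mem_cat mem_undup xs /=; apply: sh.
Qed.

Lemma block_lt p q x : x <= q -> p * q.+1 + x < p.+1 * q.+1.
Proof. by move=> lex; rewrite mulSn addnC ltn_add2r ltnS. Qed.

Lemma block_div p q x : x <= q -> (p * q.+1 + x) %/ q.+1 = p.
Proof. by move=> lex; rewrite divnMDl // divn_small ?addn0. Qed.

Section Clean.
Variables (G : sgraph) (m r : nat) (v : nat -> G) (P : nat -> nat -> seq G).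
Hypothesis cl : subdivided_clique m r v P.

(* Names of the vertices: [inner i i a] is the branch vertex [v i] and, for
   [i < j], [inner i j a] is the [a]-th inner vertex of the path from [v i] to
   [v j], which exists iff [named i j a]. *)
Definition inner i j a : G := if i == j then v i else nth (v i) (P i j) a.
Definition named i j a : bool := (i == j) || (a < size (P i j)).

Lemma inner_inj i j a k l b : i <= j < m -> k <= l < m -> named i j a -> named k l b ->
  inner i j a = inner k l b -> (i, j) = (k, l).
Proof.
have [v_inj _ vP disj] := cl.
move=> /andP[leij ltj] /andP[lekl ltl]; rewrite /named /inner.
have [eqij|neqij] := eqVneq i j; have [eqkl|neqkl] := eqVneq k l => /= na nb.
- by rewrite -eqij -eqkl => /v_inj-> //; lia.
- have ltkl : k < l by rewrite ltn_neqAle neqkl.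
  have := vP k l i ltkl ltl (leq_ltn_trans leij ltj).
  by move=> /negP vNP eqv; case: vNP; rewrite eqv mem_nth.
- have ltij : i < j by rewrite ltn_neqAle neqij.
  have := vP i j k ltij ltj (leq_ltn_trans lekl ltl).
  by move=> /negP vNP eqv; case: vNP; rewrite -eqv mem_nth.
have ltij : i < j by rewrite ltn_neqAle neqij.
have ltkl : k < l by rewrite ltn_neqAle neqkl.
move=> eqv; apply/eqP; apply: contrapT => /negP neq.
have /negP := disj i j k l (nth (v i) (P i j) a) ltij ltj ltkl ltl neq (mem_nth _ na).
by case; rewrite eqv mem_nth.
Qed.

(** Two paths involve at most four branch vertices, so patterns on four indices capture every
    adjacency between named vertices. *)
Definition color (t : seq nat) :
    {ffun ('I_4 * 'I_4 * 'I_r.+1) * ('I_4 * 'I_4 * 'I_r.+1) -> bool} :=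
  [ffun x : ('I_4 * 'I_4 * 'I_r.+1) * ('I_4 * 'I_4 * 'I_r.+1) =>
    let i := nth 0 t x.1.1.1 in let j := nth 0 t x.1.1.2 in
    let k := nth 0 t x.2.1.1 in let l := nth 0 t x.2.1.2 in
    [&& named i j x.1.2, named k l x.2.2 &
        adj (inner i j x.1.2) (inner k l x.2.2)]].

Variables (h : seq nat) (q : nat).
Hypothesis h_sorted : sorted ltn h.
Hypothesis h_lt : forall x, x \in h -> x < m.
Hypothesis h_size : 4 * q.+1 <= size h.
Hypothesis h_hom : forall t t', subseq t h -> subseq t' h ->
  size t = 4 -> size t' = 4 -> color t = color t'.

Lemma h_lt_nth i : i < size h -> nth 0 h i < m.
Proof. by move=> lti; apply/h_lt/mem_nth. Qed.

Lemma h_uniq : uniq h.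
Proof. by apply: sorted_uniq h_sorted => //; [apply: ltn_trans | apply: ltnn]. Qed.

Lemma h_mono i j : i < j -> j < size h -> nth 0 h i < nth 0 h j.
Proof.
move=> ltij ltj; apply: (sorted_ltn_nth ltn_trans 0 h_sorted) => //.
by rewrite inE (ltn_trans ltij).
Qed.

(** As neither index pair contains the other, each has an index that can move while the other pair
    stays fixed. By homogeneity the edge survives all [q * q] combinations of moves, which form the
    biclique. *)
Lemma clean_biclique i j a k l b :
  i \in h -> j \in h -> k \in h -> l \in h -> i <= j -> k <= l ->
  a <= r -> b <= r -> named i j a -> named k l b ->
  ~~ ((i \in [:: k; l]) && (j \in [:: k; l])) ->
  ~~ ((k \in [:: i; j]) && (l \in [:: i; j])) ->
  adj (inner i j a) (inner k l b) -> subgraph (biclique q) G.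
Proof.
move=> ih jh kh lh leij lekl lea leb nij nkl Nij Nkl ijkl.
have [||t [th sz_t sub_t]] := @subseq_cover _ h [:: i; j; k; l] 4 h_uniq.
- by move=> x; rewrite !inE => /or4P[]/eqP->.
- by rewrite leqnn /=; apply: leq_trans h_size; rewrite leq_pmulr.
have t_sorted : sorted ltn t := subseq_sorted ltn_trans th h_sorted.
have [it jt kt lt] : [/\ i \in t, j \in t, k \in t & l \in t].
  by split; apply: sub_t; rewrite !inE eqxx ?orbT.
have pos x : x \in t -> exists2 p : 'I_4, nth 0 t p = x & index x t = p.
  move=> xt; have ltp : index x t < 4 by rewrite -sz_t index_mem.
  by exists (Ordinal ltp); rewrite //= nth_index.
have [p1 t1 e1] := pos i it; have [p2 t2 e2] := pos j jt.
have [p3 t3 e3] := pos k kt; have [p4 t4 e4] := pos l lt.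
have pos_le x y (p p' : 'I_4) : nth 0 t p = x -> nth 0 t p' = y -> x <= y -> p <= p'.
  move=> <- <-; apply: contraTT; rewrite -!ltnNge => ltp.
  by apply: (sorted_ltn_nth ltn_trans 0 t_sorted); rewrite ?inE ?sz_t.
have le12 := pos_le _ _ _ _ t1 t2 leij; have le34 := pos_le _ _ _ _ t3 t4 lekl.
pose F1 := [:: p1; p2]; pose F2 := [:: p3; p4].
have memF x y z (p p' p'' : 'I_4) : nth 0 t p = x -> nth 0 t p' = y -> nth 0 t p'' = z ->
    p \in [:: p'; p''] -> x \in [:: y; z].
  by move=> <- <- <-; rewrite !inE => /orP[]/eqP->; rewrite eqxx ?orbT.
have N12 : (p1 \notin F2) || (p2 \notin F2).
  rewrite -negb_and; apply: contra Nij => /andP[m1 m2].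
  by rewrite (memF _ _ _ _ _ _ t1 t3 t4 m1) (memF _ _ _ _ _ _ t2 t3 t4 m2).
have N34 : (p3 \notin F1) || (p4 \notin F1).
  rewrite -negb_and; apply: contra Nkl => /andP[m3 m4].
  by rewrite (memF _ _ _ _ _ _ t3 t1 t2 m3) (memF _ _ _ _ _ _ t4 t1 t2 m4).
(* The position [p] of the pattern [t] is blown up into the [p]-th block of
   [q.+1] consecutive elements of [h]; positions in [F] stay fixed. *)
pose u (F : seq 'I_4) (c : 'I_q) (p : 'I_4) := p * q.+1 + (if p \in F then 0 else c).
pose g F c p := nth 0 h (u F c p).
have u_off (F : seq 'I_4) (c : 'I_q) (p : 'I_4) : (if p \in F then 0 else val c) <= q.
  by case: ifP => // _; apply: ltnW (ltn_ord c).
have blk_size (p : 'I_4) : p.+1 * q.+1 <= size h.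
  by apply: leq_trans h_size; rewrite leq_mul2r ltn_ord orbT.
have u_lt F c p : u F c p < size h.
  by apply: leq_trans (blk_size p); apply: block_lt; apply: u_off.
have u_blk F c p : u F c p %/ q.+1 = p by apply: block_div; apply: u_off.
have h_eq x y : x < size h -> y < size h -> nth 0 h x = nth 0 h y -> x = y.
  by move=> ltx lty /eqP; rewrite nth_uniq ?h_uniq // => /eqP.
have g_le F c (p p' : 'I_4) : p <= p' -> g F c p <= g F c p'.
  rewrite leq_eqVlt => /predU1P[/val_inj->//|ltp].
  apply/ltnW/h_mono; rewrite ?u_lt // ltnNge; apply/negP => leu.
  by have := leq_div2r q.+1 leu; rewrite !u_blk leqNgt ltp.
have g_h F c p : g F c p \in h by apply: mem_nth.
(* [T c c'] will realise both moves in one 4-subsequence: shared positions stay, those only in [F1]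
   follow [c], those only in [F2] follow [c']. *)
pose off (c c' : 'I_q) (p : 'I_4) :=
  if p \in F2 then (if p \in F1 then 0 else val c') else (if p \in F1 then val c else 0).
pose U (c c' : 'I_q) := mkseq (fun x => x * q.+1 + off c c' (inord x)) 4.
have U_lt (c c' : 'I_q) (p : 'I_4) : nth 0 (U c c') p < p.+1 * q.+1 /\ p * q.+1 <= nth 0 (U c c') p.
  rewrite nth_mkseq // inord_val leq_addr; split=> //; apply: block_lt.
  by rewrite /off; case: ifP => _; case: ifP => _ //;
    [apply: ltnW (ltn_ord c') | apply: ltnW (ltn_ord c)].
pose T c c' := map (nth 0 h) (U c c').
have T_sub c c' : subseq (T c c') h.
  apply: subseq_map_nth.
    apply/(pathP 0) => x; rewrite /= => ltx.
    have ltx4 : x < 4 by apply: ltnW.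
    have lt1 : nth 0 (U c c') x < x.+1 * q.+1 by have [] := U_lt c c' (Ordinal ltx4).
    have le1 : x.+1 * q.+1 <= nth 0 (U c c') x.+1.
      by have [] := U_lt c c' (Ordinal (ltx : x.+1 < 4)).
    by case: x {ltx4} ltx lt1 le1 => [|[|[|]]] //= _ lt1 le1; apply: leq_trans lt1 le1.
  apply/(all_nthP 0) => x; rewrite size_mkseq => ltx.
  have [+ _] := U_lt c c' (Ordinal ltx); move/leq_trans; apply.
  exact: (blk_size (Ordinal ltx)).
have T1 c c' p : p \in F1 -> nth 0 (T c c') p = g F2 c p.
  move=> pF; rewrite (nth_map 0) ?size_mkseq // /g /u nth_mkseq // inord_val /off pF.
  by case: ifP.
have T2 c c' p : p \in F2 -> nth 0 (T c c') p = g F1 c' p.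
  by move=> pF; rewrite (nth_map 0) ?size_mkseq // /g /u nth_mkseq // inord_val /off pF.
have hom c c' : [&& named (g F2 c p1) (g F2 c p2) a, named (g F1 c' p3) (g F1 c' p4) b &
    adj (inner (g F2 c p1) (g F2 c p2) a) (inner (g F1 c' p3) (g F1 c' p4) b)].
  have := h_hom th (T_sub c c') sz_t _; rewrite size_map size_mkseq => /(_ erefl).
  move/ffunP/(_ ((p1, p2, inord a), (p3, p4, inord b))); rewrite !ffunE /= !inordK //.
  have [i1 i2 i3 i4] : [/\ p1 \in F1, p2 \in F1, p3 \in F2 & p4 \in F2].
    by rewrite !inE !eqxx !orbT.
  by rewrite t1 t2 t3 t4 nij nkl ijkl (T1 _ _ _ i1) (T1 _ _ _ i2) (T2 _ _ _ i3) (T2 _ _ _ i4) => <-.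
pose f (x : biclique q) := match x with
  | inl c => inner (g F2 c p1) (g F2 c p2) a
  | inr c' => inner (g F1 c' p3) (g F1 c' p4) b
  end.
have n1 c : named (g F2 c p1) (g F2 c p2) a by have /and3P[] := hom c c.
have n2 c : named (g F1 c p3) (g F1 c p4) b by have /and3P[] := hom c c.
have r1 c : g F2 c p1 <= g F2 c p2 < m by rewrite g_le // h_lt.
have r2 c : g F1 c p3 <= g F1 c p4 < m by rewrite g_le // h_lt.
have g_inj F c c' p : p \notin F -> g F c p = g F c' p -> c = c'.
  move=> pF /h_eq; rewrite !u_lt => /(_ isT isT); rewrite /u (negPf pF) => /addnI.
  exact: val_inj.
have g_blk F F' c c' p p' : g F c p = g F' c' p' -> p = p'.
  move=> /h_eq; rewrite !u_lt => /(_ isT isT) /(congr1 (divn^~ q.+1)).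
  by rewrite !u_blk; apply: val_inj.
have cross c c' : inner (g F2 c p1) (g F2 c p2) a <> inner (g F1 c' p3) (g F1 c' p4) b.
  move=> /(inner_inj (r1 c) (r2 c') (n1 c) (n2 c')) [/g_blk eq13 /g_blk eq24].
  by move: N12; rewrite eq13 eq24 !inE !eqxx orbT.
exists f.
  move=> [c|c] [c'|c'] /=.
  - move=> /(inner_inj (r1 c) (r1 c') (n1 c) (n1 c')) [e e']; congr inl.
    by case/orP: N12 => pF; [apply: (g_inj _ _ _ _ pF e) | apply: (g_inj _ _ _ _ pF e')].
  - by move/cross.
  - by move/esym/cross.
  - move=> /(inner_inj (r2 c) (r2 c') (n2 c) (n2 c')) [e e']; congr inr.
    by case/orP: N34 => pF; [apply: (g_inj _ _ _ _ pF e) | apply: (g_inj _ _ _ _ pF e')].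
move=> [c|c] [c'|c'] //= _; first by have /and3P[] := hom c c'.
by rewrite adj_sym; have /and3P[] := hom c' c.
Qed.

(** * A long hole through the branch vertices *)

Lemma path_connect_in (T : sgraph) (A : {set T}) (x y : T) (s : seq T) :
  path (@adj T) x s -> {subset x :: s <= A} -> y \in x :: s -> connect (adj_in A) x y.
Proof.
elim: s x => [|z s IHs] x /=; first by move=> _ _; rewrite inE => /eqP->.
case/andP=> xz zs sub; rewrite inE => /predU1P[->|ys]; first exact: connect0.
apply: (@connect_trans _ _ z).
  by apply: connect1; rewrite /adj_in /= xz !sub ?inE ?eqxx ?orbT.
by apply: IHs => // u us; apply: sub; rewrite inE us orbT.
Qed.

(** Indices are now positions in [h]: equal ones stand for a branch vertex, increasing ones for an
    inner vertex of a path. *)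
Definition place i j (x : G) : Prop :=
  exists2 a, a <= r & named (nth 0 h i) (nth 0 h j) a /\ x = inner (nth 0 h i) (nth 0 h j) a.

Lemma h_mono_le i j : i <= j -> j < size h -> nth 0 h i <= nth 0 h j.
Proof. by rewrite leq_eqVlt => /predU1P[->//|ltij] ltj; apply/ltnW/h_mono. Qed.

Lemma place_branch i : place i i (v (nth 0 h i)).
Proof. by exists 0; rewrite /named /inner ?eqxx. Qed.

Lemma place_path i j x : i < j -> j < size h -> x \in P (nth 0 h i) (nth 0 h j) -> place i j x.
Proof.
move=> ltij ltj xP; have ltw := h_mono ltij ltj; have [_ szP _ _] := cl.
have [leP _] := szP _ _ ltw (h_lt_nth ltj).
have lt_idx : index x (P (nth 0 h i) (nth 0 h j)) < size (P (nth 0 h i) (nth 0 h j)).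
  by rewrite index_mem.
exists (index x (P (nth 0 h i) (nth 0 h j))); first exact: ltnW (leq_trans lt_idx leP).
by rewrite /named /inner (ltn_eqF ltw) nth_index.
Qed.

Lemma place_inj i j k l x : i <= j < size h -> k <= l < size h ->
  place i j x -> place k l x -> i = k /\ j = l.
Proof.
move=> /andP[leij ltj] /andP[lekl ltl] [a _ [na ->]] [b _ [nb]].
move/(inner_inj _ _ na nb); rewrite !h_mono_le ?h_lt_nth // => /(_ isT isT) [/eqP + /eqP].
rewrite !nth_uniq ?h_uniq // ?(leq_ltn_trans leij) ?(leq_ltn_trans lekl) //.
by move=> /eqP-> /eqP->.
Qed.

Hypothesis no_biclique : ~ subgraph (biclique q) G.

(** Any such edge would be blown up by [clean_biclique]; only vertices with nested index pairs, such
    as a path and its end, can be adjacent. *)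
Lemma place_anti i j k l x y : i <= j < size h -> k <= l < size h ->
  ~~ ((i \in [:: k; l]) && (j \in [:: k; l])) ->
  ~~ ((k \in [:: i; j]) && (l \in [:: i; j])) ->
  place i j x -> place k l y -> ~~ adj x y.
Proof.
move=> /andP[leij ltj] /andP[lekl ltl] Nij Nkl [a lea [na ->]] [b leb [nb ->]].
have lti := leq_ltn_trans leij ltj; have ltk := leq_ltn_trans lekl ltl.
have memE c d e : c < size h -> d < size h -> e < size h ->
    (nth 0 h c \in [:: nth 0 h d; nth 0 h e]) = (c \in [:: d; e]).
  by move=> ltc ltd lte; rewrite !inE !nth_uniq ?h_uniq.
apply/negP => xy; apply: no_biclique; apply: clean_biclique xy => //.
- exact: mem_nth.
- exact: mem_nth.
- exact: mem_nth.
- exact: mem_nth.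
- exact: h_mono_le.
- exact: h_mono_le.
- by rewrite !memE.
- by rewrite !memE.
Qed.

Lemma clean_path i j : i < j -> j < size h ->
  path (@adj G) (v (nth 0 h i)) (rcons (P (nth 0 h i) (nth 0 h j)) (v (nth 0 h j))).
Proof.
move=> ltij ltj; have [_ szP _ _] := cl.
by have [_] := szP _ _ (h_mono ltij ltj) (h_lt_nth ltj).
Qed.

Definition route n : {set G} :=
  [set x | [exists i : 'I_n, (x == v (nth 0 h i)) ||
     ((i.+1 < n) && (x \in P (nth 0 h i) (nth 0 h i.+1)))]].

Lemma route_branch n i : i < n -> v (nth 0 h i) \in route n.
Proof. by move=> lti; rewrite inE; apply/existsP; exists (Ordinal lti); rewrite eqxx. Qed.

Lemma route_place n x : n <= size h -> x \in route n ->
  exists i j, [/\ i <= j <= i.+1, j < n & place i j x].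
Proof.
move=> len; rewrite inE => /existsP[[i lti] /= /orP[/eqP->|/andP[ltSi xP]]].
  by exists i, i; split=> //; [rewrite leqnn leqnSn | apply: place_branch].
exists i, i.+1; split=> //; first by rewrite leqnSn leqnn.
by apply: place_path => //; apply: leq_trans len.
Qed.

Lemma route_connect n i : i < n -> n <= size h ->
  connect (adj_in (route n)) (v (nth 0 h 0)) (v (nth 0 h i)).
Proof.
elim: i => [|i IHi] lti len; first exact: connect0.
apply: connect_trans (IHi (ltnW lti) len) _.
apply: (path_connect_in (clean_path (ltnSn i) (leq_trans lti len))).
  move=> x; rewrite inE mem_rcons inE => /or3P[/eqP->|/eqP->|xP].
  - by apply: route_branch; apply: ltnW.
  - exact: route_branch.
  by rewrite inE; apply/existsP; exists (Ordinal (ltnW lti)); rewrite /= lti xP orbT.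
by rewrite inE mem_rcons inE eqxx orbT.
Qed.

(** A shortest path within the route is long, and the direct path between its end branch vertices
    closes it up. As [n > 2], the pair of [0] and [n.-1] is nested with no pair of consecutive
    indices. *)
Lemma clean_hole n : 2 < n -> n <= size h -> has_hole n.+1 G.
Proof.
move=> n_gt2 len; have n_gt0 : 0 < n by apply: leq_trans n_gt2.
have ltn1 : n.-1 < n by rewrite prednK.
have ltn1h := leq_trans ltn1 len; have lt0n1 : 0 < n.-1 by lia.
have [N [p [p0 pN pX p_ind _]]] := geodesic (route_branch n_gt0) (route_connect ltn1 len).
have [p_inj p_adj] := p_ind.
have ord_ok i j : i <= j <= i.+1 -> j < n -> i <= j < size h.
  by move=> /andP[-> _] /leq_trans; apply.
(* Adjacent vertices have index pairs that meet, so a step of [p] raises the lower index by at most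
   one. *)
have level t i j : t <= N -> i <= j <= i.+1 -> j < n -> place i j (p t) -> i <= t.
  elim: t i j => [|t IHt] i j let' leij ltj pl.
    rewrite p0 in pl; have [|<- //] := place_inj (ord_ok _ _ leij ltj) _ pl (place_branch 0).
    by rewrite (leq_trans n_gt0).
  have [k [l [lekl ltl plk]]] := route_place len (pX t (ltnW let')).
  have lekt := IHt k l (ltnW let') lekl ltl plk.
  have: adj (p t) (p t.+1) by rewrite p_adj ?eqxx // ltnW.
  apply: contraTT; rewrite -ltnNge => ltti.
  by apply: (place_anti (ord_ok _ _ lekl ltl) (ord_ok _ _ leij ltj) _ _ plk pl);
    rewrite !inE; lia.
have leN : n.-1 <= N.
  apply: (level N n.-1 n.-1 (leqnn N) _ ltn1); first by rewrite leqnn leqnSn.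
  by rewrite pN; apply: place_branch.
pose Y := [set x in P (nth 0 h 0) (nth 0 h n.-1)].
have YP x : x \in Y -> place 0 n.-1 x by rewrite inE; apply: place_path.
have ok0 : 0 <= n.-1 < size h by [].
have := clean_path lt0n1 ltn1h.
(* An empty direct path would make two distinct branch vertices adjacent. *)
case defP: (P (nth 0 h 0) (nth 0 h n.-1)) => [|z s] /=.
  have ok1 : 0 <= 0 < size h by rewrite (leq_trans n_gt0).
  have ok2 : n.-1 <= n.-1 < size h by rewrite leqnn.
  rewrite andbT => adj0n.
  suff: ~~ adj (v (nth 0 h 0)) (v (nth 0 h n.-1)) by rewrite adj0n.
  by apply: (place_anti ok1 ok2 _ _ (place_branch 0) (place_branch n.-1)); rewrite !inE; lia.
case/andP=> adj0z; rewrite rcons_path => /andP[path_s adj_last].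
have sY : {subset z :: s <= Y} by move=> x xs; rewrite inE defP.
have conn_z x : x \in Y -> connect (adj_in Y) z x.
  by rewrite inE defP; apply: path_connect_in.
suff: has_hole N.+2 G.
  by case=> k [k_ge4 lek ind]; exists k; split=> //; lia.
apply: (@hole_close G p N Y z (last z s)) => //.
- by lia.
- move=> x y xY yY; apply: connect_trans (conn_z y yY).
  by rewrite connect_adj_in_sym; apply: conn_z.
- move=> t let'; have [k [l [lekl ltl plk]]] := route_place len (pX t let').
  apply/negP => /YP pl0; have := place_inj (ord_ok _ _ lekl ltl) ok0 plk pl0; lia.
- move=> t y /andP[t_gt0 lttN] /YP pl0.
  have [k [l [lekl ltl plk]]] := route_place len (pX t (ltnW lttN)).
  (* The only index pairs on the route nested with the direct path are those of the ends of [p], and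
     [p t] is neither. *)
  have nbr c : place c c (p t) -> c < n -> c != 0 /\ c != n.-1.
    move=> [a _ [_]]; rewrite /inner eqxx => eqp ltc.
    split; apply/eqP => eqc; rewrite eqc -?p0 -?pN in eqp.
      by have := p_inj _ _ (ltnW lttN) (leq0n N) eqp; lia.
    by have := p_inj _ _ (ltnW lttN) (leqnn N) eqp; lia.
  have Nkl : ~~ ((k \in [:: 0; n.-1]) && (l \in [:: 0; n.-1])).
    rewrite !inE; have [eqkl|neqkl] := eqVneq k l; last by lia.
    by rewrite -eqkl in plk ltl *; have [] := nbr k plk ltl; lia.
  apply: (place_anti (ord_ok _ _ lekl ltl) ok0 Nkl _ plk pl0).
  by rewrite !inE; lia.
- by apply: sY; rewrite inE eqxx.
- by rewrite p0.
- by apply: sY; apply: mem_last.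
- by rewrite pN adj_sym.
Qed.

End Clean.

Theorem theorem4 (s q : nat) :
  exists X : nat, forall G : sgraph, X <= treewidth G ->
    (exists (C : sgraph) (k : nat),
        [/\ canonical C k, s <= k & induced_subgraph C G])
    \/ subgraph (biclique q) G.
Proof.
(* [r] bounds the inner vertices of a path; [n] provides four blocks of [q.+1] indices and a hole
   longer than [s]. *)
pose r := s + 3; pose n := 4 * q.+1 + s + 3.
pose C := {ffun ('I_4 * 'I_4 * 'I_r.+1) * ('I_4 * 'I_4 * 'I_r.+1) -> bool}.
have [M0 ramseyM] := @ramsey nat C [ffun=> false] 4 n.
(* [M] is positive so that some rich vertex can serve as default value; [k] is the budget of
   [rich_subdivided_clique], and [K] that of [many_rich] used with [s + 3 > 2]. *)
pose M := M0.+1; pose k := M + M * M * r + 4; pose K := M + (s + 3) * k.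
have lekK : k <= K by apply: leq_trans (leq_addl _ _); rewrite leq_pmull // addn3.
exists (3 * K).+1 => G leX; have [biq|nobiq] := pselect (subgraph (biclique q) G); first by right.
left; have [/has_H_canonical//|noH] := pselect (has_H s G).
have [/has_hole_canonical//|nohole] := pselect (has_hole s G).
have hole_le n' : s <= n' -> ~ has_hole n' G.
  by move=> les [l [l4 len ind]]; apply: nohole; exists l; split=> //; apply: leq_trans len.
have K_gt0 : 0 < K by apply: ltn_addr.
have [beta hb] := treewidth_haven K_gt0 leX.
have leR : M <= #|rich beta k|.
  apply: (many_rich hb _ (leqnn K)); first by rewrite addn3.
  by apply: hole_le; rewrite leqW // leq_addr.
have [x0 _] : exists x, x \in rich beta k by apply/card_gt0P; apply: leq_trans leR.
pose v i := nth x0 (enum (rich beta k)) i.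
have v_lt i : i < M -> i < size (enum (rich beta k)).
  by move=> lti; rewrite -cardE; apply: leq_trans leR.
have [P cl] : exists P, subdivided_clique M r v P.
  apply: (rich_subdivided_clique hb noH lekK (leqnn _)).
    by move=> i /v_lt lti; rewrite -mem_enum mem_nth.
  move=> i j /v_lt lti /v_lt ltj /eqP; rewrite nth_uniq ?enum_uniq //.
  by move/eqP.
have [|h [c [h_sub sz_h h_hom]]] := ramseyM (color r v P) (iota 0 M).
  by rewrite size_iota leqnSn.
have h_lt x : x \in h -> x < M by move/(mem_subseq h_sub); rewrite mem_iota.
have h_sorted : sorted ltn h := subseq_sorted ltn_trans h_sub (iota_ltn_sorted 0 M).
case: (@hole_le n.+1); first by rewrite /n; lia.
apply: (clean_hole cl h_sorted h_lt _ _ nobiq); rewrite ?sz_h //.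
- by rewrite /n -addnA leq_addr.
- by move=> t t' th t'h sz_t sz_t'; rewrite !h_hom.
- by rewrite /n addn3.
Qed.
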